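(* Assume $n\ge3$. (Type A) Let $Q$ be a $\mathbb{Z}_n$-minimal (that is, $\mathbb Z_n$-stable) subquiver of $K_n$, with $K$ acting by $K\cdot a^i_j=\mu_{i,j}a^{i+1}_{j+1}$. Then any $u_q(\mathfrak{sl}_2)$-action on $\Bbbk Q$ is given by $$E\cdot a^i_j=\gamma^E(q^{-2j}a^i_j-q^{-2i-2}a^{i+1}_{j+1})+\lambda^E_{i,j}a^i_{j+1},\qquad F\cdot a^i_j=\gamma^F(q^{2j}a^{i-1}_{j-1}-q^{2i+2}a^i_j)+\lambda^F_{i,j}a^{i-1}_j,$$ for scalars in $\Bbbk$ subject to the restriction $-\gamma^E\gamma^Fq^{-1}(q^2-1)^2=1$ along with: - $\lambda^E_{i,j}=0$ if $i=j$ or the arrow $a^i_{j+1}$ does not exist in $Q$; - $\lambda^F_{i,j}=0$ if $i=j$ or the arrow $a^{i-1}_j$ does not exist in $Q$; - $\lambda^E_{i+1,j+1}=q^{-2}\lambda^E_{i,j}$, $\ \lambda^F_{i+1,j+1}=q^2\lambda^F_{i,j}$, and $\lambda^F_{i,j}\lambda^E_{i-1,j}=\lambda^E_{i,j}\lambda^F_{i,j+1}$. (Type B) Let $Q$ be a $\mathbb{Z}_n$-minimal (that is, $\mathbb Z_n$-stable) subquiver of $K_{n,n}$, with $K$ acting by $K\cdot b^i_j=\mu_{i,j}b^{i+1}_{j+1}$. Then any $u_q(\mathfrak{sl}_2)$-action on $\Bbbk Q$ is given by $$E\cdot b^i_j=\gamma^E_-q^{-2j}b^i_j-\gamma^E_+q^{-2i-2}b^{i+1}_{j+1}+\lambda^E_{i,j}b^i_{j+1},\qquad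 F\cdot b^i_j=\gamma^F_-q^{2j}b^{i-1}_{j-1}-\gamma^F_+q^{2i+2}b^i_j+\lambda^F_{i,j}b^{i-1}_j,$$ for scalars in $\Bbbk$ subject to the restrictions $-\gamma^E_+\gamma^F_+q^{-1}(q^2-1)^2=1$ and $-\gamma^E_-\gamma^F_-q^{-1}(q^2-1)^2=1$, along with: - $\lambda^E_{i,j}=0$ if $i=j$ or the arrow $b^i_{j+1}$ does not exist in $Q$; - $\lambda^F_{i,j}=0$ if $i=j$ or the arrow $b^{i-1}_j$ does not exist in $Q$; - $\lambda^E_{i+1,j+1}=q^{-2}\lambda^E_{i,j}$, $\ \lambda^F_{i+1,j+1}=q^2\lambda^F_{i,j}$, and $\lambda^F_{i,j}\lambda^E_{i-1,j}=\lambda^E_{i,j}\lambda^F_{i,j+1}$; - $(\gamma^E_+)^n=(\gamma^E_-)^n+\prod_{\ell=0}^{n-1}\lambda^E_{i,j+\ell}$ and $(\gamma^F_+)^n=(\gamma^F_-)^n+\prod_{\ell=0}^{n-1}\lambda^F_{i,j+\ell}$.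
   Context: $\Bbbk$ is a field containing a primitive $2n$-th root of unity $q$. The Frobenius–Lusztig kernel $u_q(\mathfrak{sl}_2)$ is the Hopf algebra of dimension $n^3$ generated by $K,E,F$ with $\Delta(K)=K\otimes K$, $\Delta(E)=1\otimes E+E\otimes K$, $\Delta(F)=K^{-1}\otimes F+F\otimes1$, and relations $KE=q^2EK$, $KF=q^{-2}FK$, $K^n=1$, $E^n=F^n=0$, $EF-FE=\frac{K-K^{-1}}{q-q^{-1}}$. A Hopf algebra $H$ acts on an algebra $A$ if $A$ is a left $H$-module with $h\cdot(pq)=\sum(h_1\cdot p)(h_2\cdot q)$ and $h\cdot1_A=\varepsilon(h)1_A$. All actions on path algebras are assumed to preserve the path length filtration; paths compose left to right. $K_n$ is the quiver with vertices $1,\dots,n$ and one arrow $a^i_j$ from $i$ to $j$ for each ordered pair of distinct vertices; $a^i_i$ denotes the trivial path $e_i$ (and it counts as existing). $K_{n,n}$ is the quiver with vertices $1_+,\dots,n_+,1_-,\dots,n_-$ and one arrow $b^i_j$ from $i_+$ to $j_-$ for all $i,j$. All indices are modulo $n$. The group $\mathbb Z_n$, with generator identified with $K$, acts by $i\mapsto i+1$ on the vertices of $K_n$, and $i_\pm\mapsto(i+1)_\pm$ on the vertices of $K_{n,n}$, so $K\cdot e_i=e_{i+1}$, resp. $K\cdot e_{i_\pm}=e_{(i+1)_\pm}$. The $\mu_{i,j}$ are nonzero scalars in $\Bbbk$ with $\prod_{\ell=0}^{n-1}\mu_{i+\ell,j+\ell}=1$, and $\mu_{i,i}=1$ in the $K_n$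 case. The scalars $\gamma^E,\gamma^F$ are those of the action on vertices (the case $i=j$ of the Type A formulas): $E\cdot e_i=\gamma^Eq^{-2i}(e_i-q^{-2}e_{i+1})$, $F\cdot e_i=\gamma^Fq^{2i}(e_{i-1}-q^2e_i)$. In Type B, $\gamma^E_\pm,\gamma^F_\pm$ are the scalars with $E\cdot e_{i_\pm}=\gamma^E_\pm q^{-2i}(e_{i_\pm}-q^{-2}e_{(i+1)_\pm})$ and $F\cdot e_{i_\pm}=\gamma^F_\pm q^{2i}(e_{(i-1)_\pm}-q^2e_{i_\pm})$. The formulas and conditions are for pairs $(i,j)$ such that $a^i_j$ (including $i=j$), resp. $b^i_j$, lies in $Q$; a term with a zero coefficient is read as zero.
   Formalization: The formulas and conditions are stated for arrows rescaled so that all μ_{i,j}=1 (such a rescaling is proved to exist), since as printed they fail for μ≠1; in Type B the clause ''λ_{i,j}=0 if i=j'' is dropped, since λ_{i,i} can be nonzero (e.g. on K_{3,3}). *)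

(* Defs.v *)
(* Mathematical Components, with the finitely supported functions {malg k[T]}
   of the multinomials library. *)
From HB Require Import structures.
From mathcomp Require Import all_boot all_order all_algebra.
From mathcomp Require Import finmap monalg.

Set Implicit Arguments.
Unset Strict Implicit.
Unset Printing Implicit Defensive.

Import GRing.Theory.
Local Open Scope ring_scope.

(* A quiver is given inside ambient finite types V and A of possible vertices
   and arrows; only the arrows in arrs count, and src, tgt are irrelevant
   outside arrs. *)
Record quiver (V A : finType) := Quiver {
  verts : {set V};
  arrs : {set A};
  src : A -> V;
  tgt : A -> V;
  arrs_closed : forall a, a \in arrs -> (src a \in verts) && (tgt a \in verts)
}.

Definition subquiver (V A : finType) (Q Q' : quiver V A) : Prop :=
  [/\ verts Q \subset verts Q', arrs Q \subset arrs Q',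
      {in arrs Q, src Q =1 src Q'} & {in arrs Q, tgt Q =1 tgt Q'}].

Definition stable_quiver (V A : finType) (sV : V -> V) (sA : A -> A)
    (Q : quiver V A) : Prop :=
  {in verts Q, forall v, sV v \in verts Q} /\
  {in arrs Q, forall a, sA a \in arrs Q}.

(* A path is encoded by its starting vertex and its arrows, left to right. *)
Section Paths.
Variables (V A : finType) (Q : quiver V A).

Fixpoint walk (v : V) (s : seq A) : bool :=
  if s is a :: s' then [&& a \in arrs Q, src Q a == v & walk (tgt Q a) s']
  else true.

Definition walk_end (v : V) (s : seq A) : V := last v (map (tgt Q) s).

Definition is_qpath (p : V * seq A) : bool := (p.1 \in verts Q) && walk p.1 p.2.

Record qpath := QPath { qpath_val :> V * seq A; _ : is_qpath qpath_val }.
HB.instance Definition _ := [isSub for qpath_val].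
HB.instance Definition _ := [Choice of qpath by <:].

Definition qpath_len (p : qpath) : nat := size (val p).2.
Definition qstart (p : qpath) : V := (val p).1.
Definition qend (p : qpath) : V := walk_end (val p).1 (val p).2.

Lemma walk_cat v s t : walk v (s ++ t) = walk v s && walk (walk_end v s) t.
Proof.
elim: s v => [|a s IHs] v //=.
by rewrite IHs /walk_end /= !andbA.
Qed.

Lemma walk_end_cat v s t : walk_end v (s ++ t) = walk_end (walk_end v s) t.
Proof. by rewrite /walk_end map_cat last_cat. Qed.

Lemma qcat_subproof (p r : qpath) : qend p = qstart r ->
  is_qpath ((val p).1, (val p).2 ++ (val r).2).
Proof.
case: p r => [[v s] /= ps] [[w t] /= pt]; rewrite /qend /qstart /= => e.
move: ps pt; rewrite /is_qpath /= => /andP[-> ws] /andP[_ wt].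
by rewrite walk_cat ws e wt.
Qed.

Definition qcat (p r : qpath) (e : qend p = qstart r) : qpath :=
  QPath (qcat_subproof e).

Definition qcomp (p r : qpath) : option qpath :=
  match qend p =P qstart r with
  | ReflectT e => Some (qcat e)
  | ReflectF _ => None
  end.

Definition qtriv (v : V) (hv : v \in verts Q) : qpath :=
  @QPath (v, [::]) (introT andP (conj hv isT)).

End Paths.

(* The path algebra kQ; the ring is allowed to be zero, as Q may be empty. *)
Section PathAlgebra.
Variables (k : fieldType) (V A : finType) (Q : quiver V A).

Definition path_alg : Type := {malg k[qpath Q]}.
HB.instance Definition _ := GRing.Lmodule.on path_alg.

(* pbasis and path_mul are locked: unification would otherwise unfold the
   finitely supported functions. *)
Fact path_alg_key : unit. Proof. by []. Qed.

Definition pbasis : qpath Q -> path_alg :=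
  locked_with path_alg_key (fun p => << p >> : {malg k[qpath Q]}).

Lemma pbasisE p : pbasis p = (<< p >> : {malg k[qpath Q]}).
Proof. by rewrite /pbasis unlock. Qed.

Definition path_elt (p : V * seq A) : path_alg :=
  if insub p is Some r then pbasis r else 0.
(* both are 0 when the vertex, resp. the arrow, is not in Q *)
Definition vertex_elt (v : V) : path_alg := path_elt (v, [::]).
Definition arrow_elt (a : A) : path_alg := path_elt (src Q a, [:: a]).

Definition path_mulU (p r : qpath Q) : path_alg :=
  if qcomp p r is Some s then pbasis s else 0.

Definition path_mul : path_alg -> path_alg -> path_alg :=
  locked_with path_alg_key (fun x y : path_alg =>
    \sum_(p <- msupp x) \sum_(r <- msupp y)
      (mcoeff p x * mcoeff r y) *: path_mulU p r).

Lemma path_mulE x y : path_mul x y = \sum_(p <- msupp x) \sum_(r <- msupp y)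
  (mcoeff p x * mcoeff r y) *: path_mulU p r.
Proof. by rewrite /path_mul unlock. Qed.

Definition path_one : path_alg := \sum_(v in verts Q) vertex_elt v.

Lemma path_mulwE (d1 d2 : {fset qpath Q}) (x y : path_alg) :
  (msupp x `<=` d1)%fset -> (msupp y `<=` d2)%fset ->
  path_mul x y = \sum_(p <- d1) \sum_(r <- d2)
    (mcoeff p x * mcoeff r y) *: path_mulU p r.
Proof.
move=> le1 le2; rewrite path_mulE.
under eq_bigr => p _.
  rewrite (big_fset_incl _ le2) /=; first by over.
  by move=> r _ /mcoeff_outdom ->; rewrite mulr0 scale0r.
rewrite (big_fset_incl _ le1) //= => p _ /mcoeff_outdom px0.
by rewrite big1 // => r _; rewrite px0 mul0r scale0r.
Qed.

Lemma path_mulDl : left_distributive path_mul +%R.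
Proof.
move=> x y z; pose d := (msupp x `|` msupp y)%fset.
have leD : (msupp (x + y) `<=` d)%fset by exact: msuppD_le.
rewrite (path_mulwE leD (fsubset_refl _)).
rewrite (path_mulwE (fsubsetUl _ (msupp y)) (fsubset_refl (msupp z))).
rewrite (path_mulwE (fsubsetUr (msupp x) _) (fsubset_refl (msupp z))).
rewrite -big_split /=; apply: eq_bigr => p _.
rewrite -big_split /=; apply: eq_bigr => r _.
by rewrite mcoeffD mulrDl scalerDl.
Qed.

Lemma path_mulDr : right_distributive path_mul +%R.
Proof.
move=> z x y; pose d := (msupp x `|` msupp y)%fset.
have leD : (msupp (x + y) `<=` d)%fset by exact: msuppD_le.
rewrite (path_mulwE (fsubset_refl _) leD).
rewrite (path_mulwE (fsubset_refl (msupp z)) (fsubsetUl _ (msupp y))).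
rewrite (path_mulwE (fsubset_refl (msupp z)) (fsubsetUr (msupp x) _)).
rewrite -big_split /=; apply: eq_bigr => p _.
rewrite -big_split /=; apply: eq_bigr => r _.
by rewrite mcoeffD mulrDr scalerDl.
Qed.

Lemma path_mulZl c x y : path_mul (c *: x) y = c *: path_mul x y.
Proof.
have le1 : (msupp (c *: x) `<=` msupp x)%fset by exact: msuppZ_le.
rewrite (path_mulwE le1 (fsubset_refl _)) path_mulE scaler_sumr.
apply: eq_bigr => p _; rewrite scaler_sumr; apply: eq_bigr => r _.
by rewrite mcoeffZ scalerA mulrA.
Qed.

Lemma path_mulZr c x y : path_mul x (c *: y) = c *: path_mul x y.
Proof.
have le1 : (msupp (c *: y) `<=` msupp y)%fset by exact: msuppZ_le.
rewrite (path_mulwE (fsubset_refl _) le1) path_mulE scaler_sumr.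
apply: eq_bigr => p _; rewrite scaler_sumr; apply: eq_bigr => r _.
by rewrite mcoeffZ scalerA mulrCA mulrA.
Qed.

Lemma path_mul0l x : path_mul 0 x = 0.
Proof. by rewrite path_mulE msupp0 big_seq_fset0. Qed.

Lemma path_mul0r x : path_mul x 0 = 0.
Proof. by rewrite path_mulE msupp0 big1 // => p _; rewrite big_seq_fset0. Qed.

Lemma path_mul_suml (I : Type) (s : seq I) (P : pred I) (F : I -> path_alg) y :
  path_mul (\sum_(i <- s | P i) F i) y = \sum_(i <- s | P i) path_mul (F i) y.
Proof.
apply: (big_morph (path_mul^~ y)); last exact: path_mul0l.
by move=> u v; rewrite path_mulDl.
Qed.

Lemma path_mul_sumr (I : Type) (s : seq I) (P : pred I) (F : I -> path_alg) y :
  path_mul y (\sum_(i <- s | P i) F i) = \sum_(i <- s | P i) path_mul y (F i).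
Proof.
apply: (big_morph (path_mul y)); last exact: path_mul0r.
by move=> u v; rewrite path_mulDr.
Qed.

Lemma path_algE (x : path_alg) :
  x = \sum_(p <- msupp x) mcoeff p x *: pbasis p.
Proof.
rewrite [LHS]monalgE; apply: eq_bigr => p _; rewrite pbasisE.
apply/malgP => r; rewrite (mcoeffU p).
by rewrite -[RHS]/(mcoeff r (mcoeff p x *: (<< p >> : {malg k[qpath Q]})))
  (mcoeffZ (mcoeff p x)) (mcoeffU p) mulrnAr mulr1.
Qed.

Lemma path_mulUE p r : path_mul (pbasis p) (pbasis r) = path_mulU p r.
Proof.
have supp t : msupp (pbasis t) = [fset t]%fset.
  by rewrite (pbasisE t) (msuppU t) oner_eq0.
rewrite path_mulE (supp p) (supp r) !big_seq_fset1 (pbasisE p) (pbasisE r).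
by rewrite (mcoeffUU p) (mcoeffUU r) mulr1 scale1r.
Qed.

Lemma qcompA (p r s : qpath Q) :
  path_mul (pbasis p) (path_mul (pbasis r) (pbasis s)) =
  path_mul (path_mul (pbasis p) (pbasis r)) (pbasis s).
Proof.
rewrite !path_mulUE /path_mulU /qcomp.
case: (qend r =P qstart s) => [ers|nrs]; last first.
  rewrite path_mul0r; case: (qend p =P qstart r) => [epr|_]; last first.
    by rewrite path_mul0l.
  rewrite path_mulUE /path_mulU /qcomp.
  case: (_ =P _) => // e; case: nrs; rewrite -e /qend /= walk_end_cat.
  by rewrite -[walk_end Q (val p).1 _]/(qend p) epr.
case: (qend p =P qstart r) => [epr|npr]; last first.
  rewrite path_mul0l path_mulUE /path_mulU /qcomp.
  by case: (_ =P _).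
rewrite !path_mulUE /path_mulU /qcomp.
case: (_ =P _) => [e1|[]]; last by rewrite epr.
case: (_ =P _) => [e2|[]]; last first.
  rewrite -ers /qend /= walk_end_cat.
  by rewrite -[walk_end Q (val p).1 _]/(qend p) epr.
by congr (pbasis _); apply: val_inj; rewrite /= catA.
Qed.

Lemma path_mulA : associative path_mul.
Proof.
have ind (P : path_alg -> Prop) : P 0 -> (forall u v, P u -> P v -> P (u + v)) ->
    (forall c p, P (c *: pbasis p)) -> forall x, P x.
  by move=> P0 PD Pb x; rewrite [x]path_algE; apply: big_ind.
move=> x y z; elim/ind: x => [|u v eu ev|c p].
- by rewrite !path_mul0l.
- by rewrite !path_mulDl eu ev.
rewrite !path_mulZl; congr (_ *: _); elim/ind: y => [|u v eu ev|d r].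
- by rewrite path_mul0r !path_mul0l path_mul0r.
- by rewrite path_mulDr !path_mulDl path_mulDr eu ev.
rewrite (path_mulZl d (pbasis r) z).
rewrite (path_mulZr d (pbasis p) (path_mul (pbasis r) z)).
rewrite (path_mulZr d (pbasis p) (pbasis r)).
rewrite (path_mulZl d (path_mul (pbasis p) (pbasis r)) z); congr (_ *: _).
elim/ind: z => [|u v eu ev|e s].
- by rewrite !path_mul0r.
- by rewrite !path_mulDr eu ev.
by rewrite !path_mulZr qcompA.
Qed.

Lemma vertex_eltE v (hv : v \in verts Q) : vertex_elt v = pbasis (qtriv hv).
Proof.
rewrite /vertex_elt /path_elt; case: insubP => [u _ eu|]; last first.
  by rewrite /is_qpath /= hv.
by congr (pbasis _); apply: val_inj.
Qed.

Lemma vertex_mul v (p : qpath Q) : v \in verts Q ->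
  path_mul (vertex_elt v) (pbasis p) = if v == qstart p then pbasis p else 0.
Proof.
move=> hv; rewrite (vertex_eltE hv) path_mulUE /path_mulU /qcomp.
case: (_ =P _) => [e|//].
by congr (pbasis _); apply: val_inj; have /= -> : v = qstart p := e; case: p {e} => [[]].
Qed.

Lemma mul_vertex v (p : qpath Q) : v \in verts Q ->
  path_mul (pbasis p) (vertex_elt v) = if v == qend p then pbasis p else 0.
Proof.
move=> hv; rewrite (vertex_eltE hv) path_mulUE /path_mulU /qcomp.
rewrite eq_sym; case: (qend p =P v) => [e|//].
congr (pbasis _); apply: val_inj => /=; rewrite cats0.
by case: p {e} => [[]].
Qed.

Lemma qstart_in (p : qpath Q) : qstart p \in verts Q.
Proof. by case: p => [[v s] /= h]; case/andP: (h). Qed.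

Lemma qend_in (p : qpath Q) : qend p \in verts Q.
Proof.
case: p => [[v s] h]; rewrite /qend /=; case/andP: h => /=.
elim: s v => [|a s IHs] v //= hv /and3P[ha _ hs].
by rewrite /walk_end /=; apply: IHs => //; case/andP: (arrs_closed ha).
Qed.

Lemma path_mul1l : left_id path_one path_mul.
Proof.
move=> x; rewrite [x in path_mul _ x]path_algE path_mul_sumr [RHS]path_algE.
apply: eq_bigr => p _; rewrite path_mulZr; congr (_ *: _).
rewrite path_mul_suml (bigD1 (qstart p)) ?qstart_in //=.
rewrite vertex_mul ?qstart_in // eqxx big1 ?addr0 // => v /andP[hv nv].
by rewrite vertex_mul // (negbTE nv).
Qed.

Lemma path_mul1r : right_id path_one path_mul.
Proof.
move=> x; rewrite [x in path_mul x _]path_algE path_mul_suml [RHS]path_algE.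
apply: eq_bigr => p _; rewrite path_mulZl; congr (_ *: _).
rewrite path_mul_sumr (bigD1 (qend p)) ?qend_in //=.
rewrite mul_vertex ?qend_in // eqxx big1 ?addr0 // => v /andP[hv nv].
by rewrite mul_vertex // (negbTE nv).
Qed.

HB.instance Definition _ := GRing.Zmodule_isPzRing.Build path_alg
  path_mulA path_mul1l path_mul1r path_mulDl path_mulDr.

Definition path_filtration (m : nat) (x : path_alg) : Prop :=
  forall p, p \in msupp x -> (qpath_len p <= m)%N.

End PathAlgebra.

(* u_q(sl_2) by generators and relations: terms modulo the congruence uq_eq
   are the k-algebra generated by K, E, F subject to the relations. *)
Inductive uq_term (k : Type) : Type :=
  | UqK | UqE | UqF
  | UqScal of k
  | UqAdd of uq_term k & uq_term k
  | UqMul of uq_term k & uq_term k.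

Arguments UqK {k}.
Arguments UqE {k}.
Arguments UqF {k}.

Section Uq.
Variables (k : fieldType) (n : nat) (q : k).

Local Notation T := (uq_term k).
Local Notation "c %:S" := (UqScal c) (at level 2, format "c %:S").
Local Notation "x +' y" := (UqAdd x y) (at level 50, left associativity).
Local Notation "x *' y" := (UqMul x y) (at level 40, left associativity).

Fixpoint uq_pow (x : T) (m : nat) : T :=
  if m is m'.+1 then x *' uq_pow x m' else 1%:S.

Definition uq_sub (x y : T) : T := x +' (-1)%:S *' y.

(* K^-1 = K^(n-1) because K^n = 1 *)
Definition UqKV : T := uq_pow UqK n.-1.

Inductive uq_eq : T -> T -> Prop :=
  | uq_refl x : uq_eq x x
  | uq_sym x y : uq_eq x y -> uq_eq y x
  | uq_trans x y z : uq_eq x y -> uq_eq y z -> uq_eq x z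
  | uq_addCong x x' y y' : uq_eq x x' -> uq_eq y y' -> uq_eq (x +' y) (x' +' y')
  | uq_mulCong x x' y y' : uq_eq x x' -> uq_eq y y' -> uq_eq (x *' y) (x' *' y')
  | uq_addA x y z : uq_eq (x +' (y +' z)) (x +' y +' z)
  | uq_addC x y : uq_eq (x +' y) (y +' x)
  | uq_add0 x : uq_eq (0%:S +' x) x
  | uq_mulA x y z : uq_eq (x *' (y *' z)) (x *' y *' z)
  | uq_mul1l x : uq_eq (1%:S *' x) x
  | uq_mul0l x : uq_eq (0%:S *' x) 0%:S
  | uq_mulDl x y z : uq_eq ((x +' y) *' z) (x *' z +' y *' z)
  | uq_mulDr x y z : uq_eq (x *' (y +' z)) (x *' y +' x *' z)
  | uq_scalD c d : uq_eq (c + d)%:S (c%:S +' d%:S)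
  | uq_scalM c d : uq_eq (c * d)%:S (c%:S *' d%:S)
  | uq_scalC c x : uq_eq (c%:S *' x) (x *' c%:S)
  | uq_KE : uq_eq (UqK *' UqE) ((q ^+ 2)%:S *' (UqE *' UqK))
  | uq_KF : uq_eq (UqK *' UqF) ((q ^- 2)%:S *' (UqF *' UqK))
  | uq_Kn : uq_eq (uq_pow UqK n) 1%:S
  | uq_En : uq_eq (uq_pow UqE n) 0%:S
  | uq_Fn : uq_eq (uq_pow UqF n) 0%:S
  | uq_EF : uq_eq (uq_sub (UqE *' UqF) (UqF *' UqE))
                  ((q - q^-1)^-1%:S *' uq_sub UqK UqKV).

(* the comultiplication: [:: (x1, y1); ...] stands for the sum of the x_i (x) y_i *)
Fixpoint uq_comul (h : T) : seq (T * T) :=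
  match h with
  | UqK => [:: (UqK, UqK)]
  | UqE => [:: (1%:S, UqE); (UqE, UqK)]
  | UqF => [:: (UqKV, UqF); (UqF, 1%:S)]
  | UqScal c => [:: (c%:S, 1%:S)]
  | UqAdd x y => uq_comul x ++ uq_comul y
  | UqMul x y => [seq (s.1 *' t.1, s.2 *' t.2) | s <- uq_comul x, t <- uq_comul y]
  end.

Fixpoint uq_counit (h : T) : k :=
  match h with
  | UqK => 1
  | UqE => 0
  | UqF => 0
  | UqScal c => c
  | UqAdd x y => uq_counit x + uq_counit y
  | UqMul x y => uq_counit x * uq_counit y
  end.

Section Action.
Variables (V A : finType) (Q : quiver V A).
Local Notation kQ := (path_alg k Q).
Variable act : T -> {linear kQ -> kQ}.

Definition uq_module : Prop :=
  [/\ forall g h, uq_eq g h -> act g =1 act h,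
      forall c x, act c%:S x = c *: x,
      forall g h x, act (g +' h) x = act g x + act h x &
      forall g h x, act (g *' h) x = act g (act h x)].

Definition uq_action : Prop :=
  [/\ uq_module,
      forall h (x y : kQ),
        act h (x * y) = \sum_(t <- uq_comul h) act t.1 x * act t.2 y &
      forall h, act h 1 = uq_counit h *: (1 : kQ)].

Definition preserves_filtration : Prop :=
  forall h m (x : kQ), path_filtration m x -> path_filtration m (act h x).

End Action.
End Uq.

(* Vertices are indexed by 'Z_n (n > 1), the arrow from i to j being (i, j). *)
Section Kn.
Variable n : nat.
Local Notation Zn := 'Z_n.

Definition Kn : quiver Zn (Zn * Zn)%type.
Proof.
refine (@Quiver Zn (Zn * Zn)%type setT [set p | p.1 != p.2] fst snd _).
by move=> a _; rewrite !in_setT.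
Defined.

(* i_+ is inl i and i_- is inr i *)
Definition Knn : quiver (Zn + Zn)%type (Zn * Zn)%type.
Proof.
refine (@Quiver (Zn + Zn)%type (Zn * Zn)%type setT setT
          (fun p => inl p.1) (fun p => inr p.2) _).
by move=> a _; rewrite !in_setT.
Defined.

Definition shift1 (i : Zn) : Zn := i + 1.
Definition shift_pm (v : Zn + Zn) : Zn + Zn :=
  match v with inl i => inl (i + 1) | inr i => inr (i + 1) end.
Definition shift_arr (p : Zn * Zn) : Zn * Zn := (p.1 + 1, p.2 + 1).

Variable k : fieldType.

(* a^i_j and whether it exists in Q; a^i_i is the trivial path *)
Definition hasA (Q : quiver Zn (Zn * Zn)%type) (i j : Zn) : bool :=
  if i == j then i \in verts Q else (i, j) \in arrs Q.
Definition eltA (Q : quiver Zn (Zn * Zn)%type) (i j : Zn) : path_alg k Q :=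
  if i == j then vertex_elt k Q i else arrow_elt k Q (i, j).

(* b^i_j goes from i_+ to j_-, so it is never a trivial path.  In the conditions
   on lambda, "i = j" singles out the trivial paths (equal source and target),
   i.e. reads i_+ = j_- here; equality of the indices would be wrong, as
   lambda_{i,i} need not vanish for the action on kK_{n,n}. *)
Definition hasB (Q : quiver (Zn + Zn)%type (Zn * Zn)%type) (i j : Zn) : bool :=
  (i, j) \in arrs Q.
Definition eltB (Q : quiver (Zn + Zn)%type (Zn * Zn)%type) (i j : Zn) :
  path_alg k Q := arrow_elt k Q (i, j).

Definition orbit_scalars (has : Zn -> Zn -> bool) (mu : Zn -> Zn -> k) : Prop :=
  forall i j, has i j ->
    mu i j != 0 /\ \prod_(l < n) mu (i + l%:R) (j + l%:R) = 1.

(* A displayed formula for E and F without the mu's requires mu = 1: from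
   E(e_i a) = e_i (E a) + (E e_i)(K a), the coefficient of a^{i+1}_{j+1} in
   E a^i_j carries the factor mu_ij.  This normalization loses no generality:
   if K a^i_j = mu_ij a^{i+1}_{j+1}, then K permutes the rescaled arrows
   c_ij a^i_j without scalars, and such c exist as mu has product 1 along
   orbits. *)
Definition normalizes (has : Zn -> Zn -> bool) (mu c : Zn -> Zn -> k) : Prop :=
  forall i j, has i j -> c i j != 0 /\ c i j * mu i j = c (i + 1) (j + 1).

End Kn.

Arguments hasA {n} Q i j.
Arguments hasB {n} Q i j.
Arguments eltA {n} k Q i j.
Arguments eltB {n} k Q i j.

(* Main.v *)
From HB Require Import structures.
Require Import Defs.
From mathcomp Require Import all_boot all_order all_algebra.
From mathcomp Require Import finmap monalg ring.

Set Implicit Arguments.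
Unset Strict Implicit.
Unset Printing Implicit Defensive.

Import GRing.Theory.
Local Open Scope ring_scope.

(** The half of the quantum group generated by K and E acts by an automorphism
    K and a skew derivation E, that is E(xy) = x E(y) + E(x) K(y), with
    KE = q^2 EK.  Applying E to e_i = e_i e_i and to 0 = e_(i+1) e_i, and comparing
    with KE, forces E e_i = al_i e_i - al_(i+1) e_(i+1) with al_i = q^2 al_(i+1)
    ([vertex_familyP]), so al_i = gamma q^(-2i).  Applying E to a = e_i a and to
    a = a e_j then determines E a up to its corner e_i E(a) e_(j+1); since lengths
    do not grow, this corner is a combination of paths of length at most 1 from i
    to j+1, and there is at most one of these ([path_familyP], [corner_span]).
    The scalar of the corner is lambda.  This uses that K permutes the arrows
    without scalars, which the rescaling of [normalizer_exists] achieves.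

    The half generated by K and F has the same shape for the opposite product:
    F(yx) = y' F(x) + F(y) x with y' = K^-1 y, and K^-1 F = q^2 F K^-1, so that
    K^-1 plays the role of K, indices move down, and sources and targets are
    exchanged.  Hence every fact on E is proved for an arbitrary bilinear product
    and an arbitrary step d, and used twice.  The commutator EF - FE compared at
    e_(i+1), resp. at the path from i-1 to j+1, gives the relation between the
    gammas, resp. between the lambdas ([vertex_scalars_commutator],
    [path_scalars_commutator]).

    The relation between the n-th powers comes from E^n = 0.  Let be_j be the
    scalars of the targets, u = sum_j be_j f_j and w = sum_i al_i e_i.  Then
    E = X + Z + Y with X a = a u, Y a = - w K(a) and Z the remainder.  Since
    K u = q^2 u and E u = (1 - q^2) u^2, and likewise for w, these operators
    q^2-commute, and as q^2 is a primitive n-th root of unity the q-binomial formula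
    collapses to E^n = X^n + Z^n + Y^n ([qbinomial_prim]).  On an arrow the three
    powers act by be_j^n, by the product of the lambdas, and by - al_i^n
    ([path_scalars_power], [path_scalars_expn]). *)

(** * The q-binomial formula at a root of unity *)

Section QBinomial.
Variables (k : fieldType) (p : k).

Fixpoint qbin (m i : nat) : k :=
  match m, i with
  | _, 0 => 1
  | 0, _.+1 => 0
  | m'.+1, i'.+1 => p ^+ i'.+1 * qbin m' i'.+1 + qbin m' i'
  end.

Lemma qbin0 m : qbin m 0 = 1. Proof. by case: m. Qed.

Lemma qbin_small m i : (m < i)%N -> qbin m i = 0.
Proof.
elim: m i => [|m IHm] [|i] //= lt_mi.
by rewrite !IHm ?mulr0 ?addr0 // ltnW.
Qed.

Lemma qbinn m : qbin m m = 1.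
Proof. by elim: m => //= m ->; rewrite qbin_small // mulr0 add0r. Qed.

(** The ratio of two consecutive Gaussian binomials, with the denominators
    cleared as 1 - p^(i+1) may vanish. *)
Lemma qbin_ratio m i : (i <= m)%N ->
  qbin m i.+1 * (1 - p ^+ i.+1) = qbin m i * (1 - p ^+ (m - i)).
Proof.
elim: m i => [|m IHm] i le_im.
  by move: le_im; case: i => // _; rewrite /= expr0 subrr mulr0 mul0r.
case: (ltngtP i m.+1) le_im => // [lt_im|->] _; last first.
  by rewrite qbin_small // subnn expr0 subrr mulr0 mul0r.
rewrite ltnS in lt_im.
have -> : qbin m.+1 i.+1 * (1 - p ^+ i.+1) = qbin m i * (1 - p ^+ m.+1).
  rewrite /= mulrDl -mulrA IHm //.
  by rewrite -[in p ^+ m.+1](subnKC lt_im) -addSn exprD; ring.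
case: i lt_im => [|i] lt_im; first by rewrite !qbin0 subn0.
have [d def_m] : exists d, m = (i.+1 + d)%N.
  by exists (m - i.+1)%N; rewrite subnKC.
have := IHm i (ltnW lt_im); rewrite /= subSS.
have [-> ->] : (m - i = d.+1)%N /\ p ^+ m.+1 = p ^+ i.+1 * p ^+ d.+1.
  by rewrite -exprD def_m addSnnS addKn addSn.
by rewrite mulrDl => <-; ring.
Qed.

(** The second entry of row n is (1 - p^n) / (1 - p) = 0, and a zero propagates along
    the row as long as 1 - p^i <> 0. *)
Lemma qbin_prim0 n i : n.-primitive_root p -> (0 < i < n)%N -> qbin n i = 0.
Proof.
move=> p_prim; case: i => // i /= lt_in.
have nz j : (0 < j < n)%N -> 1 - p ^+ j != 0.
  case/andP=> j_gt0 lt_jn; rewrite subr_eq0 eq_sym -(expr0 p).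
  by rewrite (eq_prim_root_expr p_prim) mod0n modn_small // -lt0n.
elim: i lt_in => [|i IHi] lt_in; apply: (mulIf (nz _.+1 lt_in)).
  by rewrite qbin_ratio // subn0 (prim_expr_order p_prim) subrr mulr0 mul0r.
by rewrite (qbin_ratio (ltnW (ltnW lt_in))) (IHi (ltnW lt_in)) !mul0r.
Qed.

Variables (U : lmodType k) (f g : {linear U -> U}).
Hypothesis gf : forall u, g (f u) = p *: f (g u).

Lemma iterZ (h : {linear U -> U}) m a u : iter m h (a *: u) = a *: iter m h u.
Proof. by elim: m => //= m ->; rewrite linearZ. Qed.

Lemma iterD (h : {linear U -> U}) m u v :
  iter m h (u + v) = iter m h u + iter m h v.
Proof. by elim: m => //= m ->; rewrite linearD. Qed.

Lemma iter_qcomm m u : iter m g (f u) = p ^+ m *: f (iter m g u).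
Proof.
elim: m => [|m /= ->]; first by rewrite scale1r.
by rewrite linearZ /= gf scalerA exprSr.
Qed.

Lemma qbinomial m u : iter m (f \+ g) u =
  \sum_(i < m.+1) qbin m i *: iter (m - i) f (iter i g u).
Proof.
elim: m u => [|m IHm] u; first by rewrite big_ord1 /= scale1r.
rewrite iterSr IHm /=.
have split_i (i : 'I_m.+1) : true ->
    qbin m i *: iter (m - i) f (iter i g (f u + g u)) =
    (p ^+ i * qbin m i) *: iter (m.+1 - i) f (iter i g u) +
    qbin m i *: iter (m - i) f (iter i.+1 g u).
  move=> _; rewrite subSn -1?ltnS // iterSr iterD iterD iter_qcomm iterZ iterSr.
  by rewrite scalerDr scalerA mulrC.
rewrite (eq_bigr _ split_i) big_split /= big_ord_recl [RHS]big_ord_recl /=.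
rewrite expr0 mul1r qbin0 -addrA; congr (_ + _).
rewrite [RHS]big_ord_recr [X in _ + X]big_ord_recr /= (qbin_small (ltnSn m)).
rewrite mulr0 add0r addrA -big_split /= /bump /= subSS !subnn; congr (_ + _).
by apply: eq_bigr => i _; rewrite scalerDl.
Qed.

(** The Frobenius-like collapse: only the two extreme terms survive. *)
Lemma qbinomial_prim n u : n.-primitive_root p ->
  iter n (f \+ g) u = iter n f u + iter n g u.
Proof.
move=> p_prim; rewrite qbinomial.
have := prim_order_gt0 p_prim; case: n p_prim => // n p_prim _.
rewrite big_ord_recl big_ord_recr big1 => [|i _]; last first.
  by rewrite (qbin_prim0 p_prim) ?scale0r //; apply: ltn_ord i.
rewrite [X in _ + X]add0r (_ : nat_of_ord (lift _ _) = n.+1) //.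
by rewrite subnn qbinn qbin0 !scale1r.
Qed.
End QBinomial.

(** * Bilinear associative products *)

Section AlgebraMul.
Variables (k : fieldType) (A : lmodType k).

(** The product is a parameter, and not part of the type, so that each result can
    be applied to a product and to its opposite on one and the same module. *)
Record algebra_mul (mul : A -> A -> A) : Prop := AlgebraMul {
  algebra_mulA : associative mul;
  algebra_mul_linl : forall y, linear (mul^~ y);
  algebra_mul_linr : forall x, linear (mul x)
}.

Lemma algebra_mul_op mul : algebra_mul mul -> algebra_mul (fun x y => mul y x).
Proof. by case=> mA ml mr; split=> // x y z; rewrite mA. Qed.

Variables (mul : A -> A -> A) (mulP : algebra_mul mul).
Local Notation "x ** y" := (mul x y) (at level 40, left associativity).

Definition rmul_lin (y : A) : {linear A -> A} :=
  HB.pack (mul^~ y) (GRing.isLinear.Build _ _ _ _ _ (algebra_mul_linl mulP y)).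
Definition lmul_lin (x : A) : {linear A -> A} :=
  HB.pack (mul x) (GRing.isLinear.Build _ _ _ _ _ (algebra_mul_linr mulP x)).

Lemma amulDl x y z : (x + y) ** z = x ** z + y ** z.
Proof. exact: (linearD (rmul_lin z)). Qed.
Lemma amulDr x y z : z ** (x + y) = z ** x + z ** y.
Proof. exact: (linearD (lmul_lin z)). Qed.
Lemma amulBl x y z : (x - y) ** z = x ** z - y ** z.
Proof. exact: (linearB (rmul_lin z)). Qed.
Lemma amulBr x y z : z ** (x - y) = z ** x - z ** y.
Proof. exact: (linearB (lmul_lin z)). Qed.
Lemma amulNr x z : z ** (- x) = - (z ** x).
Proof. exact: (linearN (lmul_lin z)). Qed.
Lemma amulZl c x z : (c *: x) ** z = c *: (x ** z).
Proof. exact: (linearZ_LR (rmul_lin z)). Qed.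
Lemma amulZr c x z : z ** (c *: x) = c *: (z ** x).
Proof. exact: (linearZ_LR (lmul_lin z)). Qed.
Lemma amul0l z : 0 ** z = 0. Proof. exact: (linear0 (rmul_lin z)). Qed.
Lemma amul0r z : z ** 0 = 0. Proof. exact: (linear0 (lmul_lin z)). Qed.
Lemma amul_suml (J : Type) (r : seq J) (P : pred J) (F : J -> A) z :
  (\sum_(i <- r | P i) F i) ** z = \sum_(i <- r | P i) F i ** z.
Proof. exact: (linear_sum (rmul_lin z)). Qed.
Lemma amul_sumr (J : Type) (r : seq J) (P : pred J) (F : J -> A) z :
  z ** (\sum_(i <- r | P i) F i) = \sum_(i <- r | P i) z ** F i.
Proof. exact: (linear_sum (lmul_lin z)). Qed.
End AlgebraMul.

(** * Actions of a Borel half *)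

Section BorelActions.
Variables (k : fieldType) (p : k) (A : lmodType k) (mul : A -> A -> A).
Local Notation "x ** y" := (mul x y) (at level 40, left associativity).

(** A group-like K and a (1, K)-primitive E acting on an algebra: the two products
    are the coproducts of K and E. *)
Record borel_action (K E : A -> A) : Prop := BorelAction {
  borel_K_mul : forall x y, K (x ** y) = K x ** K y;
  borel_E_mul : forall x y, E (x ** y) = x ** E y + E x ** K y;
  borel_KE : forall x, K (E x) = p *: E (K x);
  borel_K_inj : injective K
}.

Variables (I : finZmodType).

(** Trivial paths: orthogonal idempotents that K permutes with step d.  The last
    two fields hold when E preserves the span of the trivial paths. *)
Record vertex_family (K E : A -> A) (d : I) (e : I -> A) : Prop := VertexFamily {
  vertex_idem : forall i j, e i ** e j = if i == j then e i else 0;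
  vertex_neq0 : forall i, e i != 0;
  vertex_K : forall i, K (e i) = e (i + d);
  vertex_E_left : forall i, exists c, e i ** E (e i) = c *: e i;
  vertex_E_right : forall i, exists c, E (e i) ** e (i + d) = c *: e (i + d)
}.

(** Short paths x i j from e i to f j; x i j = 0 stands for a missing path.  In the
    last field, the left-hand side is the part of E (x i j) between e i and
    f (j + d), which is left undetermined by the Leibniz rule. *)
Record path_family (K E : A -> A) (d : I) (e f : I -> A) (x : I -> I -> A) : Prop :=
  PathFamily {
  path_start : forall i j, e i ** x i j = x i j;
  path_end : forall i j, x i j ** f j = x i j;
  path_K : forall i j, K (x i j) = x (i + d) (j + d);
  path_E_corner : forall i j,
    exists c, e i ** (E (x i j) ** f (j + d)) = c *: x i (j + d)
}.

(** The normal form of E on the trivial paths; the recursion on al says that al is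
    a geometric progression of ratio p^-1 along the step d. *)
Definition vertex_scalars (E : A -> A) (d : I) (e : I -> A) (al : I -> k) : Prop :=
  (forall i, E (e i) = al i *: e i - al (i + d) *: e (i + d)) /\
  (forall i, al i = p * al (i + d)).

(** The normal form of E on short paths, with al the scalars of the sources and be
    those of the targets.  The scalars la of missing paths are 0, which makes the
    recursion on la hold for all indices. *)
Definition path_scalars (E : A -> A) (d : I) (al be : I -> k) (x : I -> I -> A)
    (la : I -> I -> k) : Prop :=
  [/\ forall i j, E (x i j) = be j *: x i j - al (i + d) *: x (i + d) (j + d)
                              + la i j *: x i (j + d),
      forall i j, x i j = 0 -> la i j = 0,
      forall i j, x i (j + d) = 0 -> la i j = 0 &
      forall i j, la i j = p * la (i + d) (j + d)].

Hypothesis mulP : algebra_mul mul.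

Section Families.
Variables (K E : {linear A -> A}) (KEP : borel_action K E) (d : I).
Hypothesis d_neq0 : d != 0.

Lemma addd_neq (i : I) : (i + d == i) = false.
Proof. by rewrite -subr_eq0 addrAC subrr add0r (negbTE d_neq0). Qed.

(** E e_i lies in the span of e_i and e_(i+d) by the Leibniz rule for e_i e_i; the
    rule for e_(i+d) e_i = 0 ties the second coefficient at i to the first one at
    i + d, and KE = p EK gives the recursion. *)
Lemma vertex_familyP e : vertex_family K E d e ->
  exists al, vertex_scalars E d e al.
Proof.
move=> [idem nz Ke /fin_all_exists[al lE] /fin_all_exists[be rE]].
have Ee i : E (e i) = al i *: e i + be i *: e (i + d).
  have {1}-> : e i = e i ** e i by rewrite idem eqxx.
  by rewrite (borel_E_mul KEP) Ke lE rE.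
have sE i : be i = - al (i + d).
  have := borel_E_mul KEP (e (i + d)) (e i).
  rewrite idem addd_neq linear0 !Ee Ke (amulDl mulP) (amulDr mulP).
  rewrite !(amulZl mulP) !(amulZr mulP) !idem !addd_neq eqxx !scaler0.
  rewrite add0r addr0 -scalerDl => /esym/eqP.
  by rewrite scaler_eq0 (negbTE (nz _)) orbF addr_eq0 => /eqP.
exists al; split=> i; first by rewrite Ee sE scaleNr.
have := congr1 (mul (e (i + d))) (borel_KE KEP (e i)).
rewrite Ke !Ee linearD !linearZ /= !Ke !(amulZr mulP) !(amulDr mulP) !(amulZr mulP).
rewrite !idem eqxx eq_sym addd_neq !scaler0 !addr0 scalerA => /eqP.
by rewrite -subr_eq0 -scalerBl scaler_eq0 (negbTE (nz _)) orbF subr_eq0 => /eqP.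
Qed.

Section Paths.
Variables (e f : I -> A) (x : I -> I -> A) (al be : I -> k).
Hypotheses (eP : vertex_family K E d e) (fP : vertex_family K E d f).
Hypotheses (xP : path_family K E d e f x).
Hypotheses (alP : vertex_scalars E d e al) (beP : vertex_scalars E d f be).

(** Multiplication by idempotents on both sides reads off one component. *)
Lemma path_pick a b i j :
  e a ** (x i j ** f b) = if (a == i) && (b == j) then x i j else 0.
Proof.
rewrite -(path_end xP i j) -(algebra_mulA mulP) (vertex_idem fP) (eq_sym b).
have [_|_] := altP (j =P b); last by rewrite andbF !(amul0r mulP).
rewrite -(path_start xP i j) !(algebra_mulA mulP) (vertex_idem eP).
have [->|_] := altP (a =P i); last by rewrite !(amul0l mulP).
by rewrite !(path_start xP) (path_end xP).
Qed.

(** The Leibniz rule for x = e_i x gives the term in x (i + d) (j + d) and that for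
    x = x f_j the term in x; what they leave is the corner of E x, a multiple of
    x i (j + d). *)
Lemma path_familyP : exists la, path_scalars E d al be x la.
Proof.
have /fin_all_exists[la0 la0P] (i : I) :
    exists la_i : I -> k, forall j,
      e i ** (E (x i j) ** f (j + d)) = la_i j *: x i (j + d).
  exact: (fin_all_exists (path_E_corner xP i)).
(* la0 is arbitrary at missing paths *)
pose la i j := if (x i j == 0) || (x i (j + d) == 0) then 0 else la0 i j.
have laP i j : e i ** (E (x i j) ** f (j + d)) = la i j *: x i (j + d).
  rewrite la0P /la; have [x0|_] := altP (x i j =P 0).
    have := la0P i j; rewrite x0 linear0 (amul0l mulP) (amul0r mulP) => <-.
    by rewrite scale0r.
  by have [->|_] := altP (x i (j + d) =P 0); rewrite ?scaler0.
have x0 i j : x (i + d) (j + d) = 0 -> x i j = 0.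
  rewrite -(path_K xP) => Kx0; apply: (borel_K_inj KEP).
  by rewrite Kx0 linear0.
have Ex i j : E (x i j) = be j *: x i j - al (i + d) *: x (i + d) (j + d)
                              + la i j *: x i (j + d).
  have Er : E (x i j) = be j *: x i j + E (x i j) ** f (j + d).
    rewrite -{1}(path_end xP i j) (borel_E_mul KEP) (proj1 beP) (vertex_K fP).
    congr (_ + _); rewrite (amulBr mulP) !(amulZr mulP) (path_end xP).
    rewrite -{2}(path_end xP i j) -(algebra_mulA mulP) (vertex_idem fP).
    by rewrite eq_sym addd_neq (amul0r mulP) scaler0 subr0.
  have El : E (x i j) = e i ** E (x i j) - al (i + d) *: x (i + d) (j + d).
    rewrite -{1}(path_start xP i j) (borel_E_mul KEP) (proj1 alP) (path_K xP).
    congr (_ + _); rewrite (amulBl mulP) !(amulZl mulP) (path_start xP).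
    rewrite -(path_start xP (i + d)) (algebra_mulA mulP) (vertex_idem eP).
    by rewrite eq_sym addd_neq (amul0l mulP) scaler0 sub0r.
  rewrite Er -addrA; congr (_ + _); rewrite [in LHS]El (amulBl mulP).
  rewrite -(algebra_mulA mulP) laP (amulZl mulP) (path_end xP).
  by rewrite addrC.
exists la; split=> // i j.
- by rewrite /la => ->; rewrite eqxx.
- by rewrite /la => ->; rewrite eqxx orbT.
have [xj0|xj_neq0] := eqVneq (x i (j + d)) 0.
  have Kxj0 : x (i + d) (j + d + d) = 0 by rewrite -(path_K xP) xj0 linear0.
  by rewrite /la xj0 Kxj0 !eqxx !orbT mulr0.
have := congr1 K (laP i j).
rewrite !(borel_K_mul KEP) (borel_KE KEP) (vertex_K eP) (vertex_K fP) linearZ /=.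
rewrite !(path_K xP) (amulZl mulP) (amulZr mulP) laP scalerA => /eqP.
rewrite -subr_eq0 -scalerBl scaler_eq0 subr_eq0 => /orP[/eqP-> //|/eqP/x0 xj0].
by rewrite xj0 eqxx in xj_neq0.
Qed.

(** The element with coordinates al is an eigenvector of K that E maps to a multiple
    of its square.  These two facts are what makes the operators in the proof of
    [path_scalars_power] commute up to p. *)
Lemma vertex_weight (e0 : I -> A) (al0 : I -> k) :
    vertex_family K E d e0 -> vertex_scalars E d e0 al0 ->
  let u := \sum_i al0 i *: e0 i in
  K u = p *: u /\ E u = (1 - p) *: (u ** u).
Proof.
move=> e0P [E0 al0d] u.
have shift (h : I -> A) : \sum_i h (i + d) = \sum_i h i.
  by rewrite [RHS](reindex_inj (addIr d)).
split.
  rewrite linear_sum /= scaler_sumr -[RHS]shift; apply: eq_bigr => i _.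
  by rewrite linearZ /= (vertex_K e0P) al0d scalerA.
have uu : u ** u = \sum_i al0 i ^+ 2 *: e0 i.
  rewrite (amul_suml mulP); apply: eq_bigr => i _.
  rewrite (amul_sumr mulP) (bigD1 i) //= big1 => [|j ne_ji].
    by rewrite addr0 (amulZl mulP) (amulZr mulP) (vertex_idem e0P) eqxx scalerA.
  rewrite (amulZl mulP) (amulZr mulP) (vertex_idem e0P) eq_sym (negbTE ne_ji).
  by rewrite !scaler0.
rewrite uu scalerBl scale1r linear_sum /=.
under eq_bigr do rewrite linearZ /= E0 scalerBr !scalerA -expr2.
rewrite sumrB scaler_sumr; congr (_ - _); rewrite -[RHS]shift.
by apply: eq_bigr => i _; rewrite al0d scalerA -mulrA -expr2.
Qed.

(** On a path, X is the diagonal term be, Y the term of step (d, d) and Z the term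
    of step (0, d) of the normal form of E.  As operators on the whole algebra,
    H = E - X satisfies HX = p XH, and H = Z + Y with YZ = p ZY. *)
Lemma path_scalars_power n la : n.-primitive_root p -> d *+ n = 0 ->
    (forall a, iter n E a = 0) -> path_scalars E d al be x la ->
  forall i j, x i j != 0 ->
  be j ^+ n + \prod_(l < n) la i (j + d *+ l)
    + \prod_(l < n) - al (i + d *+ l.+1) = 0.
Proof.
move=> p_prim dn0 En0 [Ex _ _ _] i j xij_neq0.
have [Ku Eu] := vertex_weight fP beP; set u := \sum_j be j *: f j in Ku Eu.
have [Kw Ew] := vertex_weight eP alP; set w := \sum_i al i *: e i in Kw Ew.
pose X := rmul_lin mulP u; pose W := lmul_lin mulP w \o K.
pose H : {linear A -> A} := E \- X.
pose Y : {linear A -> A} := \- W.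
pose Z : {linear A -> A} := H \- Y.
have XE a : X a = a ** u by [].
have WE a : W a = w ** K a by [].
have HE a : H a = E a - a ** u by [].
have ZE a : Z a = H a + W a by rewrite /Z /Y /= opprK.
have HX a : H (X a) = p *: X (H a).
  rewrite !(HE, XE) (borel_E_mul KEP) Eu Ku (amulBl mulP) !(amulZr mulP).
  rewrite (algebra_mulA mulP) scalerBl scale1r scalerBr addrAC.
  by rewrite [_ - _ - _]addrAC subrr add0r addrC.
have HW a : H (W a) = w ** H (K a) + (1 - p) *: (w ** w ** K (K a)).
  rewrite !(HE, WE) (borel_E_mul KEP) Ew (amulBr mulP) (amulZl mulP).
  by rewrite (algebra_mulA mulP) addrAC.
have WH a : W (H a) = p *: (w ** H (K a)).
  rewrite !(HE, WE) linearB /= (borel_KE KEP) (borel_K_mul KEP) Ku.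
  by rewrite (amulZr mulP) -scalerBr (amulZr mulP).
have WW a : W (W a) = p *: (w ** w ** K (K a)).
  by rewrite !WE (borel_K_mul KEP) Kw (amulZl mulP) (amulZr mulP) (algebra_mulA mulP).
have YZ a : Y (Z a) = p *: Z (Y a).
  have YE b : Y b = - W b by [].
  rewrite !YE [Z (- _)]linearN scalerN; congr (- _).
  have WD b c : W (b + c) = W b + W c by exact: linearD.
  rewrite !ZE WD WH WW HW -!scalerDr; congr (_ *: _).
  by rewrite scalerBl scale1r -addrA subrK.
have En : iter n E (x i j) =
    iter n X (x i j) + (iter n Z (x i j) + iter n Y (x i j)).
  have -> : iter n E (x i j) = iter n (X \+ H) (x i j).
    by apply: eq_iter => a; rewrite /= addrC subrK.
  rewrite (qbinomial_prim HX _ p_prim); congr (_ + _).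
  rewrite -(qbinomial_prim YZ _ p_prim).
  by apply: eq_iter => a; rewrite /= subrK.
have xu a b : x a b ** u = be b *: x a b.
  rewrite -(path_end xP a b) -(algebra_mulA mulP) (amul_sumr mulP).
  rewrite (bigD1 b) //= big1 => [|j' ne_j'].
    by rewrite addr0 (amulZr mulP) (vertex_idem fP) eqxx (amulZr mulP).
  by rewrite (amulZr mulP) (vertex_idem fP) eq_sym (negbTE ne_j') scaler0.
have wx a b : w ** x a b = al a *: x a b.
  rewrite -(path_start xP a b) (algebra_mulA mulP) (amul_suml mulP).
  rewrite (bigD1 a) //= big1 => [|i' ne_i'].
    by rewrite addr0 (amulZl mulP) (vertex_idem eP) eqxx (amulZl mulP).
  by rewrite (amulZl mulP) (vertex_idem eP) (negbTE ne_i') scaler0.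
have Zx a b : Z (x a b) = la a b *: x a (b + d).
  rewrite ZE HE Ex xu WE (path_K xP) wx -[X in X - _]addrA.
  by rewrite [X in X - _]addrC addrK [LHS]addrC addNKr.
have ZS c b : Z (c *: b) = c *: Z b by exact: linearZ_LR.
have YS c b : Y (c *: b) = c *: Y b by exact: linearZ_LR.
have iterX m : iter m X (x i j) = be j ^+ m *: x i j.
  elim: m => [|m IHm]; first by rewrite scale1r.
  by rewrite iterS IHm XE (amulZl mulP) xu scalerA exprSr.
have iterZ m : iter m Z (x i j) = (\prod_(l < m) la i (j + d *+ l)) *: x i (j + d *+ m).
  elim: m => [|m IHm]; first by rewrite big_ord0 scale1r addr0.
  by rewrite iterS IHm ZS Zx scalerA big_ord_recr /= -addrA -mulrSr.
have iterY m : iter m Y (x i j) =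
    (\prod_(l < m) - al (i + d *+ l.+1)) *: x (i + d *+ m) (j + d *+ m).
  elim: m => [|m IHm]; first by rewrite big_ord0 scale1r !addr0.
  rewrite iterS IHm YS.
  rewrite -[Y (x _ _)]/(- (w ** K (x _ _))) (path_K xP) wx -scaleNr scalerA.
  by rewrite big_ord_recr /= -!addrA -mulrSr.
have /esym/eqP := En; rewrite En0 iterX iterZ iterY !dn0 !addr0 -!scalerDl.
by rewrite scaler_eq0 (negbTE xij_neq0) orbF addrA => /eqP.
Qed.

End Paths.
End Families.
End BorelActions.

(** * Powers of the scalars *)

Section VertexScalars.
Variables (k : fieldType) (p : k) (A : lmodType k) (I : finZmodType).
Variables (E : A -> A) (d : I) (e : I -> A) (al : I -> k).
Hypotheses (p_neq0 : p != 0) (alP : vertex_scalars p E d e al).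

Lemma vertex_scalar_addl i m : al (i + d *+ m) = p ^- m * al i.
Proof.
elim: m => [|m IHm]; first by rewrite addr0 expr0 invr1 mul1r.
apply: (mulfI p_neq0); rewrite mulrSr addrA -(proj2 alP) IHm exprS invfM.
by rewrite !mulrA divff // mul1r.
Qed.

End VertexScalars.

Section RootOfUnity.
Variables (k : fieldType) (n : nat) (q : k).
Hypothesis (q_prim : (2 * n)%N.-primitive_root q).

Lemma prim2n_gt0 : (0 < n)%N.
Proof. by have := prim_order_gt0 q_prim; rewrite muln_gt0. Qed.

Lemma prim2n_neq0 : q != 0.
Proof. by rewrite (prim_root_eq0 q_prim) muln_eq0 /= -lt0n prim2n_gt0. Qed.

Lemma prim2n_sqr : n.-primitive_root (q ^+ 2).
Proof.
have := exp_prim_root q_prim 2.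
by rewrite (gcdn_idPl (dvdn_mulr n (dvdnn 2))) mulKn.
Qed.

Lemma prim2n_sqr_neq1 : (1 < n)%N -> q ^+ 2 - 1 != 0.
Proof.
move=> n_gt1; rewrite subr_eq0 -(expr0 q) (eq_prim_root_expr q_prim) mod0n.
by rewrite modn_small // -[X in (X < _)%N]muln1 ltn_pmul2l.
Qed.

Lemma prim2n_half : q ^+ n = -1.
Proof.
have /eqP : (q ^+ n) ^+ 2 = 1 by rewrite -exprM mulnC prim_expr_order.
rewrite sqrf_eq1 => /orP[|/eqP//].
rewrite -(expr0 q) (eq_prim_root_expr q_prim) mod0n modn_small.
  by rewrite eqn0Ngt prim2n_gt0.
by rewrite mul2n -addnn -[X in (X < _)%N]addn0 ltn_add2l prim2n_gt0.
Qed.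

Lemma prod_sqr_powers m : \prod_(l < m) (q ^+ 2) ^+ l = q ^+ (m * m.-1).
Proof.
elim: m => [|m IHm]; first by rewrite big_ord0.
rewrite big_ord_recr IHm /= -!exprM -exprD; congr (_ ^+ _).
by case: m {IHm} => // m; rewrite [(m.+1 * m.+1.-1)%N]mulnC -mulnDl addn2.
Qed.

Lemma prim2n_prod_sqr_powers : \prod_(l < n) (q ^+ 2) ^+ l = (-1) ^+ n.-1.
Proof. by rewrite prod_sqr_powers exprM prim2n_half. Qed.

Definition gamma_condition (gE gF : k) : Prop :=
  - (gE * gF * q^-1 * (q ^+ 2 - 1) ^+ 2) = 1.

(** Provides the scalars of an empty family of vertices. *)
Lemma gamma_condition_ex : (1 < n)%N -> exists gE gF, gamma_condition gE gF.
Proof.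
move=> /prim2n_sqr_neq1 p1; have q0 := prim2n_neq0.
exists 1, (- (q / (q ^+ 2 - 1) ^+ 2)); rewrite /gamma_condition.
by field; rewrite q0 p1.
Qed.

End RootOfUnity.

Section FamilyPowers.
Variables (k : fieldType) (n : nat) (q : k).
Hypothesis (q_prim : (2 * n)%N.-primitive_root q).
Variables (A : lmodType k) (mul : A -> A -> A) (mulP : algebra_mul mul).
Variables (K E : {linear A -> A}) (KEP : borel_action (q ^+ 2) mul K E).
Variables (I : finZmodType) (d : I) (e f : I -> A) (x : I -> I -> A) (al be : I -> k).
Hypotheses (d_neq0 : d != 0) (dn0 : d *+ n = 0) (En0 : forall a, iter n E a = 0).
Hypotheses (eP : vertex_family mul K E d e) (fP : vertex_family mul K E d f).
Hypotheses (xP : path_family mul K E d e f x).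
Hypotheses (alP : vertex_scalars (q ^+ 2) E d e al).
Hypotheses (beP : vertex_scalars (q ^+ 2) E d f be).

(** The contribution - al_i^n of Y collects the sign (-1)^n and the product of the
    p^-l, which is (-1)^(n-1) because q^n = -1. *)
Lemma path_scalars_expn la i j : path_scalars (q ^+ 2) E d al be x la ->
  x i j != 0 -> al i ^+ n = be j ^+ n + \prod_(l < n) la i (j + d *+ l).
Proof.
move=> laP xij_neq0.
have p_prim := prim2n_sqr q_prim.
have p_neq0 : q ^+ 2 != 0 by rewrite expf_neq0 ?(prim2n_neq0 q_prim).
have := path_scalars_power mulP KEP eP fP xP alP beP p_prim dn0 En0 laP xij_neq0.
have -> : \prod_(l < n) - al (i + d *+ l.+1) = - al i ^+ n.
  under eq_bigr do
    rewrite (vertex_scalar_addl p_neq0 alP) -mulN1r mulrA exprS invfM mulrA.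
  rewrite !big_split /= !prodr_const !card_ord prodfV (prim2n_prod_sqr_powers q_prim).
  rewrite exprVn (prim_expr_order p_prim) invr1 mulr1.
  case: (n) (prim2n_gt0 q_prim) => // m _ /=.
  by rewrite exprS mulN1r mulNr divff ?signr_eq0 // mulNr mul1r.
by move/eqP; rewrite subr_eq0 => /eqP.
Qed.

End FamilyPowers.

(** * The two Borel halves and their commutator *)

Section UqAction.
Variables (k : fieldType) (q : k) (A : lmodType k) (mul : A -> A -> A).
Local Notation "x ** y" := (mul x y) (at level 40, left associativity).
Local Notation mul_op := (fun x y => mul y x).

(** KV stands for the inverse of K.  The second field says that F is a
    (K^-1, 1)-skew derivation: in the opposite product it is of the same type as E,
    with K^-1 in the place of K. *)
Record uq_algebra_action (K KV E F : A -> A) : Prop := UqAlgebraAction {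
  uq_borel : borel_action (q ^+ 2) mul K E;
  uq_borel_op : borel_action (q ^+ 2) mul_op KV F;
  uq_commutator : forall a, E (F a) - F (E a) = (q - q^-1)^-1 *: (K a - KV a)
}.

Hypothesis mulP : algebra_mul mul.
Variables (K KV E F : {linear A -> A}) (act : uq_algebra_action K KV E F).
Variables (I : finZmodType) (d : I).
Hypotheses (d_neq0 : d != 0) (dd_neq0 : d + d != 0).

Lemma addd_subd_neq (a : I) : (a + d == a - d) = false.
Proof.
rewrite -subr_eq0 opprB addrA [a + d + d - a]addrC -addrA addKr.
exact: negbTE.
Qed.

Definition uq_vertex_family (e : I -> A) : Prop :=
  vertex_family mul K E d e /\ vertex_family mul_op KV F (- d) e.

Definition uq_path_family (e f : I -> A) (x : I -> I -> A) : Prop :=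
  path_family mul K E d e f x /\
  path_family mul_op KV F (- d) f e (fun j i => x i j).

Definition uq_vertex_scalars (e : I -> A) (aE aF : I -> k) : Prop :=
  vertex_scalars (q ^+ 2) E d e aE /\ vertex_scalars (q ^+ 2) F (- d) e aF.

(** The component at e_(i+d) of (EF - FE) e_i is a multiple of K e_i; the other
    neighbour e_(i-d) is different because 2d <> 0. *)
Lemma vertex_scalars_commutator e aE aF :
  uq_vertex_family e -> uq_vertex_scalars e aE aF ->
  forall i, aE (i + d) * (aF (i + d) - aF i) = (q - q^-1)^-1.
Proof.
move=> [eP eP'] [aEP aFP] i.
have E0 j : E (e j) = aE j *: e j - aE (j + d) *: e (j + d) by case: aEP.
have F0 j : F (e j) = aF j *: e j - aF (j - d) *: e (j - d) by case: aFP.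
have := congr1 (mul (e (i + d))) (uq_commutator act (e i)).
rewrite E0 F0 !linearB !linearZ /= !E0 !F0 (vertex_K eP) (vertex_K eP').
rewrite !(amulDr mulP, amulNr mulP, amulZr mulP) !addrK !subrK !(vertex_idem eP).
rewrite eqxx (addd_neq d_neq0) addd_subd_neq.
rewrite !(scaler0, oppr0, addr0, add0r).
rewrite !scalerN opprK !scalerA -scaleNr -scalerDl => /eqP.
rewrite -subr_eq0 -scalerBl scaler_eq0 (negbTE (vertex_neq0 eP _)) orbF subr_eq0.
by move=> /eqP <-; ring.
Qed.

(** K and K^-1 have no component at the path from i - d to j + d, so EF and FE agree
    there; each reaches it in one way only. *)
Lemma path_scalars_commutator e f x aE aF bE bF lE lF :
    uq_vertex_family e -> uq_vertex_family f -> uq_path_family e f x ->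
    path_scalars (q ^+ 2) E d aE bE x lE ->
    path_scalars (q ^+ 2) F (- d) bF aF (fun j i => x i j) lF ->
  forall i j, lF j i * lE (i - d) j = lE i j * lF (j + d) i.
Proof.
move=> [eP eP'] [fP fP'] [xP xP'] [Ex _ lE0 _] [Fx _ lF0 _] i j.
have [x0|x_neq0] := eqVneq (x (i - d) (j + d)) 0.
  by rewrite (lE0 _ _ x0) (lF0 _ _ x0) !mulr0.
pose T : {linear A -> A} := lmul_lin mulP (e (i - d)) \o rmul_lin mulP (f (j + d)).
have Tx a b : T (x a b) = if (i - d == a) && (j + d == b) then x a b else 0.
  exact: (path_pick mulP eP fP xP).
have subd a : (a - d == a) = false.
  by rewrite -{2}(subrK d a) eq_sym (addd_neq d_neq0).
have T1 : T (x (i - d) (j + d)) = x (i - d) (j + d) by rewrite Tx !eqxx.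
have Ti b : T (x i b) = 0 by rewrite Tx subd.
have Tid b : T (x (i + d) b) = 0 by rewrite Tx eq_sym addd_subd_neq.
have Tj a : T (x a j) = 0 by rewrite Tx (addd_neq d_neq0) andbF.
have Tjd a : T (x a (j - d)) = 0 by rewrite Tx addd_subd_neq andbF.
have lin3 (G : {linear A -> A}) c1 c2 c3 u v w :
    G (c1 *: u - c2 *: v + c3 *: w) = c1 *: G u - c2 *: G v + c3 *: G w.
  by rewrite linearD linearB !linearZ.
have TE a b : T (E (x a b)) = bE b *: T (x a b)
    - aE (a + d) *: T (x (a + d) (b + d)) + lE a b *: T (x a (b + d)).
  by rewrite Ex lin3.
have TF a b : T (F (x a b)) = aF a *: T (x a b)
    - bF (b - d) *: T (x (a - d) (b - d)) + lF b a *: T (x (a - d) b).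
  by rewrite Fx lin3.
have TEF : T (E (F (x i j))) = (lF j i * lE (i - d) j) *: x (i - d) (j + d).
  rewrite Fx (lin3 E) (lin3 T) !TE !subrK !Tj !Ti !Tid !Tjd T1.
  by rewrite !(scaler0, oppr0, addr0, add0r) scalerA.
have TFE : T (F (E (x i j))) = (lE i j * lF (j + d) i) *: x (i - d) (j + d).
  rewrite Ex (lin3 F) (lin3 T) !TF !addrK !Tj !Ti !Tid !Tjd T1.
  by rewrite !(scaler0, oppr0, addr0, add0r) scalerA.
have := congr1 T (uq_commutator act (x i j)).
rewrite linearB linearZ_LR linearB TEF TFE (path_K xP) (path_K xP') Tid Tjd.
rewrite subrr scaler0 => /eqP.
by rewrite -scalerBl scaler_eq0 (negbTE x_neq0) orbF subr_eq0 => /eqP.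
Qed.

End UqAction.

(** * Explicit scalars for the cyclic group *)

Section Cyclic.
Variables (k : fieldType) (n : nat) (q : k).
Hypotheses (n_ge3 : (3 <= n)%N) (q_prim : (2 * n)%N.-primitive_root q).
Variables (A : lmodType k) (mul : A -> A -> A) (mulP : algebra_mul mul).
Variables (K KV E F : {linear A -> A}).
Hypothesis (act : uq_algebra_action q mul K KV E F).

Lemma Zp_add11_neq0 : 1 + 1 != 0 :> 'Z_n.
Proof. by case: n n_ge3 => [|[|[|m]]]. Qed.

Definition gammaE (g : k) (i : 'Z_n) := g * q ^- (2 * i)%N.
Definition gammaF (g : k) (i : 'Z_n) := - (g * q ^+ (2 * i + 2)%N).

(** The exponents are representatives in [0, n[, which q^2 does not see. *)
Lemma exp2_succ (i : 'Z_n) : q ^+ (2 * (i + 1)%R)%N = q ^+ (2 * i + 2)%N.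
Proof.
have val_i1 : nat_of_ord (i + 1) = (i.+1 %% n)%N.
  rewrite /= modnDmr addn1; congr (_ %% _)%N; apply: Zp_cast.
  exact: leq_trans n_ge3.
rewrite val_i1 exprM (prim_expr_mod (prim2n_sqr q_prim)) -exprM.
by rewrite mulnS addnC.
Qed.

Lemma gammaE_succ g i : gammaE g (i + 1) = g * q ^- (2 * i + 2)%N.
Proof. by rewrite /gammaE exp2_succ. Qed.

Lemma gammaF_pred g i : gammaF g (i - 1) = - (g * q ^+ (2 * i)%N).
Proof. by rewrite /gammaF -exp2_succ subrK. Qed.

Lemma vertex_scalars_formula e gE gF :
    uq_vertex_scalars q E F 1 e (gammaE gE) (gammaF gF) -> forall i,
  E (e i) = gE *: (q ^- (2 * i)%N *: (e i - q ^- 2 *: e (i + 1))) /\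
  F (e i) = gF *: (q ^+ (2 * i)%N *: (e (i - 1) - q ^+ 2 *: e i)).
Proof.
case=> [[Ee _] [Fe _]] i; rewrite Ee Fe gammaE_succ gammaF_pred /gammaE /gammaF.
rewrite !(exprD q (2 * i) 2) invfM !scalerBr !scalerA !scaleNr opprK.
by split; [rewrite mulrA | rewrite addrC mulrA].
Qed.

(** When the trivial paths themselves are members x i i of a family of short paths,
    their two normal forms must agree, so that the extra terms vanish. *)
Lemma vertex_path_scalars0 e gE gF (x : 'Z_n -> 'Z_n -> A) i l m :
    uq_vertex_scalars q E F 1 e (gammaE gE) (gammaF gF) -> (forall j, x j j = e j) ->
    E (x i i) = (gE * q ^- (2 * i)%N) *: x i i
                - (gE * q ^- (2 * i + 2)%N) *: x (i + 1) (i + 1) + l *: x i (i + 1) ->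
    F (x i i) = (gF * q ^+ (2 * i)%N) *: x (i - 1) (i - 1)
                - (gF * q ^+ (2 * i + 2)%N) *: x i i + m *: x (i - 1) i ->
  (x i (i + 1) != 0 -> l = 0) /\ (x (i - 1) i != 0 -> m = 0).
Proof.
case=> [[Ee _] [Fe _]] xe; rewrite !xe Ee Fe gammaE_succ gammaF_pred => El Fm.
split=> nz; apply/eqP.
  have /eqP : l *: x i (i + 1) = 0.
    by apply: (addrI (E (e i))); rewrite Ee gammaE_succ -El addr0.
  by rewrite scaler_eq0 (negbTE nz) orbF.
have /eqP : m *: x (i - 1) i = 0.
  apply: (addrI (F (e i))); rewrite {1}Fe gammaF_pred /gammaF !scaleNr opprK.
  by rewrite [- _ + _]addrC -Fm addr0 Fe gammaF_pred.
by rewrite scaler_eq0 (negbTE nz) orbF.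
Qed.

Lemma eq_vertex_scalars (E0 : A -> A) (d : 'Z_n) e al al' : al =1 al' ->
  vertex_scalars (q ^+ 2) E0 d e al -> vertex_scalars (q ^+ 2) E0 d e al'.
Proof. by move=> eq_al [E0e ald]; split=> i; rewrite -!eq_al. Qed.

Lemma uq_vertex_familyP e : uq_vertex_family mul K KV E F 1 e ->
  exists gE gF, gamma_condition q gE gF /\
    uq_vertex_scalars q E F 1 e (gammaE gE) (gammaF gF).
Proof.
have q0 := prim2n_neq0 q_prim; have p0 : q ^+ 2 != 0 by rewrite expf_neq0.
have p1 := prim2n_sqr_neq1 q_prim (ltnW n_ge3).
move=> eP; have [eP1 eP2] := eP.
have d0 : - 1 != 0 :> 'Z_n by rewrite oppr_eq0 oner_neq0.
have [aE aEP] := vertex_familyP mulP (uq_borel act) (oner_neq0 'Z_n) eP1.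
have [aF aFP] := vertex_familyP (algebra_mul_op mulP) (uq_borel_op act) d0 eP2.
have EF := vertex_scalars_commutator mulP act (oner_neq0 'Z_n) Zp_add11_neq0 eP
             (conj aEP aFP) 0.
(* gF is defined by aF i = - gF q^(2i+2) at i = 0 *)
exists (aE 0), (- (aF 0 * q ^- 2)); split.
  have aE0 := proj2 aEP 0; have aF1 := proj2 aFP (0 + 1); rewrite addrK in aF1.
  rewrite aF1 in EF; rewrite /gamma_condition aE0.
  have -> : - (q ^+ 2 * aE (0 + 1) * - (aF 0 * q ^- 2) * q^-1 * (q ^+ 2 - 1) ^+ 2)
      = aE (0 + 1) * (q ^+ 2 * aF 0 - aF 0) * (q^-1 * (q ^+ 2 - 1)) by field.
  by rewrite EF; field; rewrite q0 -expr2 p1.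
split.
  apply: (eq_vertex_scalars _ aEP) => i.
  rewrite -{1}[i]natr_Zp -[i%:R]add0r (vertex_scalar_addl p0 aEP) /gammaE.
  by rewrite exprM mulrC.
apply: (eq_vertex_scalars _ aFP) => i.
have := vertex_scalar_addl p0 aFP i i.
rewrite mulNrn natr_Zp subrr /gammaF => ->.
by rewrite exprD (exprM q 2); field; rewrite q0 !expf_neq0.
Qed.

Lemma uq_path_familyP e f x gEe gFe gEf gFf :
    uq_vertex_family mul K KV E F 1 e -> uq_vertex_family mul K KV E F 1 f ->
    uq_vertex_scalars q E F 1 e (gammaE gEe) (gammaF gFe) ->
    uq_vertex_scalars q E F 1 f (gammaE gEf) (gammaF gFf) ->
    uq_path_family mul K KV E F 1 e f x ->
    (forall a, iter n E a = 0) -> (forall a, iter n F a = 0) ->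
  exists lE lF : 'Z_n -> 'Z_n -> k, forall i j, x i j != 0 ->
  [/\ E (x i j) = (gEf * q ^- (2 * j)%N) *: x i j
                  - (gEe * q ^- (2 * i + 2)%N) *: x (i + 1) (j + 1)
                  + lE i j *: x i (j + 1) /\
      F (x i j) = (gFf * q ^+ (2 * j)%N) *: x (i - 1) (j - 1)
                  - (gFe * q ^+ (2 * i + 2)%N) *: x i j + lF i j *: x (i - 1) j,
      (x i (j + 1) = 0 -> lE i j = 0) /\ (x (i - 1) j = 0 -> lF i j = 0),
      lE (i + 1) (j + 1) = q ^- 2 * lE i j /\ lF (i + 1) (j + 1) = q ^+ 2 * lF i j,
      lF i j * lE (i - 1) j = lE i j * lF i (j + 1) &
      gEe ^+ n = gEf ^+ n + \prod_(l < n) lE i (j + l%:R) /\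
      gFe ^+ n = gFf ^+ n + \prod_(l < n) lF i (j + l%:R)].
Proof.
have q0 := prim2n_neq0 q_prim; have p0 : q ^+ 2 != 0 by rewrite expf_neq0.
have d0 : 1 != 0 :> 'Z_n := oner_neq0 _.
have d0' : - 1 != 0 :> 'Z_n by rewrite oppr_eq0.
have n0 : 1 *+ n = 0 :> 'Z_n.
  by rewrite -[LHS]/(n%:R) pchar_Zp // (leq_trans _ n_ge3).
have n0' : (- 1) *+ n = 0 :> 'Z_n by rewrite mulNrn n0 oppr0.
move=> eP fP [eE eF] [fE fF] xP En0 Fn0.
have [[eP1 eP2] [fP1 fP2] [xP1 xP2]] := And3 eP fP xP.
have mulPop := algebra_mul_op mulP.
have [lE lEP] := path_familyP mulP (uq_borel act) d0 eP1 fP1 xP1 eE fE.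
have [lF lFP] := path_familyP mulPop (uq_borel_op act) d0' fP2 eP2 xP2 fF eF.
have powE := path_scalars_expn q_prim mulP (uq_borel act) n0 En0 eP1 fP1 xP1 eE fE lEP.
have powF := path_scalars_expn q_prim mulPop (uq_borel_op act) n0' Fn0
               fP2 eP2 xP2 fF eF lFP.
have comm := path_scalars_commutator mulP act d0 Zp_add11_neq0 eP fP xP lEP lFP.
case: lEP lFP => [Ex _ lE0 lEd] [Fx _ lF0 lFd].
exists lE, (fun i j => lF j i) => i j x0; split.
- rewrite Ex Fx gammaE_succ gammaF_pred.
  by split=> //; rewrite /gammaF !scaleNr opprK [- _ + _]addrC.
- by split=> [/lE0|/lF0].
- split; first by rewrite (lEd i j) mulKf.
  by rewrite (lFd (j + 1)) !addrK.
- exact: comm.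
have qX m : (q ^+ (2 * m)) ^+ n = 1.
  by rewrite -exprM mulnAC exprM (prim_expr_order q_prim) expr1n.
have gEX g (l : 'Z_n) : gammaE g l ^+ n = g ^+ n.
  by rewrite /gammaE exprMn exprVn qX invr1 mulr1.
have gFX g (l : 'Z_n) : gammaF g l ^+ n = (-1) ^+ n * g ^+ n.
  by rewrite /gammaF [LHS]exprNn exprMn addnC -mulnS qX mulr1.
split; first by have := powE i j x0; rewrite !gEX.
(* the product over the paths ending at j, which is what F^n = 0 gives, becomes the
   product over those starting at i, up to the powers of q^2 *)
have lFshift l b : lF (j + l%:R) b = (q ^+ 2) ^+ l * lF j (b + (- 1) *+ l).
  elim: l b => [|l IHl] b; first by rewrite mul1r !addr0.
  rewrite lFd -natr1 addrA addrK IHl mulrA -exprS -addrA.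
  by rewrite [(-1) *+ l.+1]mulrS.
rewrite (eq_bigr _ (fun (l : 'I_n) _ => lFshift l i)) big_split /=.
rewrite (prim2n_prod_sqr_powers q_prim).
have := powF j i x0; rewrite !gFX.
have -> : (-1) ^+ n = - (-1) ^+ n.-1 :> k.
  by case: (n) (prim2n_gt0 q_prim) => // m _; rewrite exprS mulN1r.
set s := (-1) ^+ _; set P := \prod_(l < n) _ => powFE.
have s1 : s * s = 1 by rewrite -expr2 sqrr_sign.
have -> : P = s * gFe ^+ n - s * gFf ^+ n.
  by rewrite -[P](addKr (- s * gFe ^+ n)) -powFE !mulNr opprK.
by rewrite mulrBr !mulrA s1 !mul1r addrC subrK.
Qed.
End Cyclic.

(** * Components of elements of the path algebra *)

Lemma linear_comb_span (k : fieldType) (U W : lmodType k) (T : {linear U -> W})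
    (J : eqType) (r : seq J) (a : J -> k) (b : J -> U) (x : W) :
  (forall j, j \in r -> exists c, T (b j) = c *: x) ->
  exists c, T (\sum_(j <- r) a j *: b j) = c *: x.
Proof.
move=> spanT; rewrite linear_sum big_seq.
apply: (big_ind (fun z => exists c, z = c *: x)).
- by exists 0; rewrite scale0r.
- by move=> _ _ [c ->] [d ->]; exists (c + d); rewrite scalerDl.
by move=> j /spanT[c Tb]; exists (a j * c); rewrite linearZ /= Tb scalerA.
Qed.

Section PathAlgebraFacts.
Variables (k : fieldType) (V A : finType) (Q : quiver V A).
Local Notation kQ := (path_alg k Q).
Local Notation mul := (@path_mul k V A Q).

Lemma path_algebra_mul : algebra_mul mul.
Proof.
split=> [|y a u v|x a u v]; first exact: path_mulA.
  by rewrite path_mulDl path_mulZl.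
by rewrite path_mulDr path_mulZr.
Qed.

Lemma path_elt_val (p : qpath Q) : path_elt k Q (val p) = pbasis k p.
Proof. by rewrite /path_elt valK. Qed.

Lemma path_elt_out (w : V * seq A) : ~~ is_qpath Q w -> path_elt k Q w = 0.
Proof. by move=> nw; rewrite /path_elt insubN. Qed.

Lemma msupp_pbasis (p : qpath Q) : msupp (pbasis k p) = [fset p]%fset.
Proof. by rewrite (pbasisE k p) (msuppU p) oner_eq0. Qed.

Lemma pbasis_neq0 (p : qpath Q) : pbasis k p != 0.
Proof.
apply/eqP => p0; have := msupp_pbasis p.
by rewrite p0 msupp0 => /fsetP/(_ p); rewrite !inE eqxx.
Qed.

Lemma filtration_pbasis m c (p : qpath Q) :
  (qpath_len p <= m)%N -> path_filtration m (c *: pbasis k p).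
Proof.
move=> le_m r /(fsubsetP (msuppZ_le c _)).
by rewrite msupp_pbasis inE => /eqP->.
Qed.

Lemma filtration0 m : path_filtration m (0 : kQ).
Proof. by move=> r; rewrite msupp0. Qed.

Lemma linear_span (T : {linear kQ -> kQ}) (x y : kQ) :
  (forall p, p \in msupp y -> exists c, T (pbasis k p) = c *: x) ->
  exists c, T y = c *: x.
Proof. by move=> spanT; rewrite [y]path_algE; apply: linear_comb_span. Qed.

Lemma vertex_vertex u v : u \in verts Q -> v \in verts Q ->
  mul (vertex_elt k Q u) (vertex_elt k Q v) =
  if u == v then vertex_elt k Q u else 0.
Proof.
move=> hu hv; rewrite (vertex_eltE k hv) vertex_mul //.
by rewrite /qstart /=; case: eqP => // ->; rewrite -(vertex_eltE k hv).
Qed.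

Lemma vertex_elt_neq0 v : v \in verts Q -> vertex_elt k Q v != 0.
Proof. by move=> hv; rewrite (vertex_eltE k hv) pbasis_neq0. Qed.

(** The component of y between u and v is a combination of the paths from u to v of
    length at most m. *)
Lemma corner_span m u v x y : u \in verts Q -> v \in verts Q ->
    path_filtration m y ->
    (forall p : qpath Q, qstart p = u -> qend p = v -> (qpath_len p <= m)%N ->
       exists c, pbasis k p = c *: x) ->
  exists c, mul (vertex_elt k Q u) (mul y (vertex_elt k Q v)) = c *: x.
Proof.
move=> hu hv fy spanx; have mulP := path_algebra_mul.
pose T : {linear kQ -> kQ} :=
  lmul_lin mulP (vertex_elt k Q u) \o rmul_lin mulP (vertex_elt k Q v).
apply: (linear_span (T := T)) => p /fy le_m.
rewrite -[T _]/(mul _ (mul _ _)) mul_vertex //.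
case: (v =P qend p) => [ev|_]; last by exists 0; rewrite path_mul0r scale0r.
rewrite vertex_mul //.
case: (u =P qstart p) => [eu|_]; last by exists 0; rewrite scale0r.
by apply: spanx.
Qed.

Lemma filtration0_span u y : u \in verts Q -> path_filtration 0 y ->
  (exists c, mul (vertex_elt k Q u) y = c *: vertex_elt k Q u) /\
  (exists c, mul y (vertex_elt k Q u) = c *: vertex_elt k Q u).
Proof.
move=> hu fy; have mulP := path_algebra_mul.
have triv p : p \in msupp y ->
    qend p = qstart p /\ pbasis k p = vertex_elt k Q (qstart p).
  move/fy; case: p => -[v [|a s]] pP // _; split=> //.
  by rewrite -path_elt_val.
split; [apply: (linear_span (T := lmul_lin mulP _)) => p /triv[_ ep]
       |apply: (linear_span (T := rmul_lin mulP _)) => p /triv[eqp ep]].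
- rewrite -[lmul_lin _ _ _]/(mul _ _) vertex_mul // ep.
  by case: eqP => [<-|_]; [exists 1; rewrite scale1r|exists 0; rewrite scale0r].
- rewrite -[rmul_lin _ _ _]/(mul _ _) mul_vertex // ep eqp.
  by case: eqP => [<-|_]; [exists 1; rewrite scale1r|exists 0; rewrite scale0r].
Qed.

End PathAlgebraFacts.

Section ShortPaths.
Variables (k : fieldType) (V A : finType) (Q : quiver V A).
Local Notation kQ := (path_alg k Q).

Lemma short_pathP (p : qpath Q) : (qpath_len p <= 1)%N ->
  (qend p = qstart p /\ pbasis k p = vertex_elt k Q (qstart p)) \/
  exists a, [/\ a \in arrs Q, qstart p = src Q a, qend p = tgt Q a
              & pbasis k p = arrow_elt k Q a].
Proof.
rewrite -path_elt_val; case: p => -[v [|a [|b s]]] pP // _; first by left.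
right; exists a; rewrite /qstart /qend /arrow_elt /=.
by case/andP: (pP) => /= _ /and3P[ha /eqP-> _].
Qed.

Lemma arrow_pathP a : a \in arrs Q -> exists p : qpath Q,
  [/\ qstart p = src Q a, qend p = tgt Q a, (qpath_len p <= 1)%N
    & arrow_elt k Q a = pbasis k p].
Proof.
move=> ha; have pP : is_qpath Q (src Q a, [:: a]).
  by rewrite /is_qpath /= ha eqxx; case/andP: (arrs_closed ha) => ->.
by exists (QPath pP); split; rewrite // -path_elt_val.
Qed.

Lemma arrow_elt_out a : a \notin arrs Q -> arrow_elt k Q a = 0.
Proof.
by move=> ha; rewrite /arrow_elt path_elt_out // /is_qpath /= (negbTE ha) andbF.
Qed.

Lemma vertex_elt_out v : v \notin verts Q -> vertex_elt k Q v = 0.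
Proof.
by move=> hv; rewrite /vertex_elt path_elt_out // /is_qpath /= (negbTE hv).
Qed.

Variables (I : Type) (s t : I -> V).
(** The paths of length at most 1 from s i to t j are at most one in number, so that
    modulo longer paths the corner at (s i, t j) is spanned by elt i j. *)
Record short_path_system (has : I -> I -> bool) (elt : I -> I -> kQ) : Prop :=
  ShortPathSystem {
  short_path_in : forall i j, has i j -> exists p : qpath Q,
    [/\ qstart p = s i, qend p = t j, (qpath_len p <= 1)%N & elt i j = pbasis k p];
  short_path_out : forall i j, ~~ has i j -> elt i j = 0;
  short_path_only : forall i j (p : qpath Q), qstart p = s i -> qend p = t j ->
    (qpath_len p <= 1)%N -> has i j /\ pbasis k p = elt i j
}.
End ShortPaths.

(** * From the quantum group acting on a path algebra to the two Borel halves *)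

Section UqPathAlgebra.
Variables (k : fieldType) (n : nat) (q : k) (V A : finType) (Q : quiver V A).
Local Notation kQ := (path_alg k Q).
Local Notation mul := (@path_mul k V A Q).
Variable (act : uq_term k -> {linear kQ -> kQ}).
Hypotheses (n_gt0 : (0 < n)%N) (q_neq0 : q != 0).
Hypotheses (actP : uq_action n q act).

Lemma uq_act_pow h m x : act (uq_pow h m) x = iter m (act h) x.
Proof.
have [[_ scal _ prod] _ _] := actP.
by elim: m => [|m IHm] /=; rewrite ?scal ?scale1r // prod IHm.
Qed.

Lemma uq_act_Kn x : iter n (act UqK) x = x.
Proof.
have [[eqv scal _ _] _ _] := actP.
by rewrite -uq_act_pow (eqv _ _ (uq_Kn n q)) scal scale1r.
Qed.

Lemma uq_act_En x : iter n (act UqE) x = 0.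
Proof.
have [[eqv scal _ _] _ _] := actP.
by rewrite -uq_act_pow (eqv _ _ (uq_En n q)) scal scale0r.
Qed.

Lemma uq_act_Fn x : iter n (act UqF) x = 0.
Proof.
have [[eqv scal _ _] _ _] := actP.
by rewrite -uq_act_pow (eqv _ _ (uq_Fn n q)) scal scale0r.
Qed.

Local Notation aK := (act UqK).
Local Notation aKV := (act (UqKV k n)).
Local Notation aE := (act UqE).
Local Notation aF := (act UqF).

Lemma uq_act_KKV x : aK (aKV x) = x.
Proof. by rewrite uq_act_pow -iterS prednK // uq_act_Kn. Qed.

Lemma uq_act_KVK x : aKV (aK x) = x.
Proof. by rewrite uq_act_pow -iterSr prednK // uq_act_Kn. Qed.

Lemma uq_act_K_mul x y : aK (mul x y) = mul (aK x) (aK y).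
Proof. by have [_ com _] := actP; have := com UqK x y; rewrite big_seq1. Qed.

Lemma uq_path_algebra_action : uq_algebra_action q mul aK aKV aE aF.
Proof.
have [[eqv scal add prod] com _] := actP.
split; [split|split|].
- exact: uq_act_K_mul.
- by move=> x y; have := com UqE x y; rewrite big_cons big_seq1 /= scal scale1r.
- by move=> x; have := eqv _ _ (uq_KE n q) x; rewrite !prod scal.
- exact: can_inj uq_act_KVK.
- move=> x y; apply: (can_inj uq_act_KVK).
  by rewrite uq_act_K_mul !uq_act_KKV.
- move=> x y; have := com UqF y x; rewrite big_cons big_seq1 /= scal scale1r.
  by rewrite addrC.
- move=> x; apply: (can_inj uq_act_KVK); rewrite uq_act_KKV linearZ /=.
  have := eqv _ _ (uq_KF n q) (aKV x); rewrite !prod scal => ->.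
  by rewrite uq_act_KKV scalerA divff ?expf_neq0 // scale1r.
- exact: can_inj uq_act_KKV.
move=> x; have := eqv _ _ (uq_EF n q) x.
by rewrite /uq_sub !(add, prod, scal) !scaleN1r.
Qed.

Hypothesis filtP : preserves_filtration act.

Lemma uq_path_vertex_family (s : 'Z_n -> V) : injective s ->
    (forall i, s i \in verts Q) ->
    (forall i, aK (vertex_elt k Q (s i)) = vertex_elt k Q (s (i + 1))) ->
  uq_vertex_family mul aK aKV aE aF 1 (fun i => vertex_elt k Q (s i)).
Proof.
move=> s_inj sV Ks.
have idem i j : mul (vertex_elt k Q (s i)) (vertex_elt k Q (s j)) =
    if i == j then vertex_elt k Q (s i) else 0.
  by rewrite vertex_vertex // (inj_eq s_inj).
have filt0 h i : path_filtration 0 (act h (vertex_elt k Q (s i))).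
  apply: filtP; rewrite (vertex_eltE k (sV i)) -[pbasis _ _]scale1r.
  exact: filtration_pbasis.
split; split=> //.
- by move=> i; apply: vertex_elt_neq0.
- by move=> i; have [] := filtration0_span (sV i) (filt0 UqE i).
- by move=> i; have [] := filtration0_span (sV (i + 1)) (filt0 UqE i).
- by move=> i j; rewrite idem eq_sym; case: eqP => // ->.
- by move=> i; apply: vertex_elt_neq0.
- by move=> i; rewrite -[i in LHS](subrK 1) -Ks uq_act_KVK.
- by move=> i; have [] := filtration0_span (sV i) (filt0 UqF i).
- by move=> i; have [] := filtration0_span (sV (i - 1)) (filt0 UqF i).
Qed.

Lemma uq_path_path_family (s t : 'Z_n -> V) (x : 'Z_n -> 'Z_n -> kQ) :
    (forall i, s i \in verts Q) -> (forall i, t i \in verts Q) ->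
    (forall i j, x i j = 0 \/ exists (p : qpath Q) (c : k),
       [/\ qstart p = s i, qend p = t j, (qpath_len p <= 1)%N
         & x i j = c *: pbasis k p]) ->
    (forall i j (p : qpath Q), qstart p = s i -> qend p = t j ->
       (qpath_len p <= 1)%N -> exists c, pbasis k p = c *: x i j) ->
    (forall i j, aK (x i j) = x (i + 1) (j + 1)) ->
  uq_path_family mul aK aKV aE aF 1
    (fun i => vertex_elt k Q (s i)) (fun j => vertex_elt k Q (t j)) x.
Proof.
move=> sV tV x_path x_span Kx.
have x_start i j : mul (vertex_elt k Q (s i)) (x i j) = x i j.
  have [->|[p [c [ps _ _ ->]]]] := x_path i j; first by rewrite path_mul0r.
  by rewrite (path_mulZr c _ (pbasis k p)) (vertex_mul k p (sV i)) ps eqxx.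
have x_end i j : mul (x i j) (vertex_elt k Q (t j)) = x i j.
  have [->|[p [c [_ pt _ ->]]]] := x_path i j; first by rewrite path_mul0l.
  by rewrite (path_mulZl c (pbasis k p)) (mul_vertex k p (tV j)) pt eqxx.
have filt1 h i j : path_filtration 1 (act h (x i j)).
  apply: filtP; have [->|[p [c [_ _ le1 ->]]]] := x_path i j.
    exact: filtration0.
  exact: filtration_pbasis.
split; split=> //.
- move=> i j; apply: (corner_span (sV i) (tV _) (filt1 UqE i j)).
  exact: x_span.
- move=> j i; rewrite -[i in LHS](subrK 1) -[j in LHS](subrK 1) -Kx.
  exact: uq_act_KVK.
move=> j i; rewrite -path_mulA.
apply: (corner_span (sV _) (tV j) (filt1 UqF i j)).
exact: x_span.
Qed.

End UqPathAlgebra.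

(** * Rescaling the arrows *)

Section Normalizers.
Variables (k : fieldType) (n : nat).
Hypothesis n_gt1 : (1 < n)%N.

Lemma shift_closed (P : 'Z_n -> 'Z_n -> Prop) i j :
  (forall i j, P i j -> P (i + 1) (j + 1)) -> P i j ->
  forall m, P (i + m) (j + m).
Proof.
move=> Pshift Pij m; rewrite -[m]natr_Zp; elim: (m : nat) => [|l IHl].
  by rewrite !addr0.
by rewrite -natr1 !addrA; apply: Pshift.
Qed.

(** The rescaling is the product of the mu met on the way from source 0 to source i;
    it is consistent when i wraps around because mu has product 1 along orbits. *)
Lemma normalizer_exists (has : 'Z_n -> 'Z_n -> bool) (mu : 'Z_n -> 'Z_n -> k) :
    (forall i j, has i j -> has (i + 1) (j + 1)) -> orbit_scalars has mu ->
  exists c, normalizes has mu c /\ ((forall i, mu i i = 1) -> forall i, c i i = 1).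
Proof.
move=> has_shift muP.
pose c (i j : 'Z_n) := \prod_(0 <= l < i) mu l%:R (l%:R + (j - i)).
exists c; split=> [i j hij|mu1 i]; last first.
  by rewrite /c subrr big1 // => l _; rewrite addr0 mu1.
have hasD m : has m (m + (j - i)).
  have := shift_closed has_shift hij (m - i).
  by rewrite addrCA subrr addr0 addrCA addrA.
split.
  by rewrite /c big_mkord; apply/prodf_neq0 => l _; case: (muP _ _ (hasD l%:R)).
have eqd : j + 1 - (i + 1) = j - i by rewrite opprD addrACA subrr addr0.
have c_recr : c i j * mu i j = \prod_(0 <= l < i.+1) mu l%:R (l%:R + (j - i)).
  by rewrite big_nat_recr //= natr_Zp addrCA subrr addr0.
have val_i1 : nat_of_ord (i + 1) = (i.+1 %% n)%N.
  by rewrite /= modnDmr addn1; congr (_ %% _)%N; apply: Zp_cast.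
have : (i < n)%N by have := ltn_ord i; move: (nat_of_ord i) => l; rewrite Zp_cast.
rewrite leq_eqVlt c_recr => /orP[/eqP eq_in|lt_in]; last first.
  by rewrite /c eqd val_i1 modn_small.
rewrite /c val_i1 eq_in modnn [RHS]big_geq // big_mkord.
have [_ prod1] := muP _ _ (hasD 0); rewrite -[RHS]prod1.
by apply: eq_bigr => l _; rewrite !add0r addrC.
Qed.
End Normalizers.

Lemma linear_rescale (k : fieldType) (U W : lmodType k) (T : {linear U -> W})
    (u : U) (w : W) (c m c' : k) :
  T u = m *: w -> c * m = c' -> T (c *: u) = c' *: w.
Proof. by move=> Tu <-; rewrite linearZ_LR Tu scalerA. Qed.

Lemma scaler_factor (k : fieldType) (U : lmodType k) (g c d : k) (t u v w : U) :
  t = (g * c) *: u - (g * d) *: v + w -> t = g *: (c *: u - d *: v) + w.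
Proof. by rewrite scalerBr !scalerA. Qed.

(** * Subquivers of the two complete quivers *)

Section SystemA.
Variables (k : fieldType) (n : nat) (Q : quiver 'Z_n ('Z_n * 'Z_n)%type).
Hypothesis Q_sub : subquiver Q (Kn n).

Lemma eltA_system : short_path_system id id (hasA Q) (eltA k Q).
Proof.
have [_ sub_a srcQ tgtQ] := Q_sub; split=> i j.
- rewrite /hasA /eltA; have [<- hi|_ ha] := eqVneq i j.
    by exists (qtriv hi); split; rewrite // -vertex_eltE.
  have [p [ps pt le1 pb]] := arrow_pathP k ha.
  by exists p; split; rewrite // ?ps ?srcQ // pt tgtQ.
- rewrite /hasA /eltA; case: eqP => _; first exact: vertex_elt_out.
  exact: arrow_elt_out.
move=> p ps pt /(short_pathP k)[[pe pb]|[a [ha pa pa' pb]]].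
  move: pt; rewrite pe ps => <-; rewrite /hasA /eltA eqxx -{1}[i]ps.
  by rewrite qstart_in pb ps.
have ne_a : a.1 != a.2 by have := subsetP sub_a _ ha; rewrite inE.
rewrite /hasA /eltA; rewrite srcQ // ps in pa; rewrite tgtQ // pt in pa'.
by rewrite /id /= in pa pa'; rewrite pa pa' /= (negbTE ne_a) -surjective_pairing.
Qed.

Lemma hasA_shift : stable_quiver (@shift1 n) (@shift_arr n) Q ->
  forall i j, hasA Q i j -> hasA Q (i + 1) (j + 1).
Proof.
case=> stV stA i j; rewrite /hasA (inj_eq (addIr 1)).
by case: eqP => [_ /stV|_ /stA].
Qed.

Lemma hasA_vertex i j : hasA Q i j -> i \in verts Q.
Proof.
have [_ _ srcQ _] := Q_sub; rewrite /hasA; case: eqP => // _ ha.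
by have /andP[] := arrs_closed ha; rewrite srcQ.
Qed.
End SystemA.

Section SystemB.
Variables (k : fieldType) (n : nat) (Q : quiver ('Z_n + 'Z_n)%type ('Z_n * 'Z_n)%type).
Hypothesis Q_sub : subquiver Q (Knn n).

Lemma eltB_system : short_path_system inl inr (hasB Q) (eltB k Q).
Proof.
have [_ _ srcQ tgtQ] := Q_sub; split=> i j.
- move=> ha; have [p [ps pt le1 pb]] := arrow_pathP k ha.
  by exists p; split; rewrite // ?ps ?srcQ // pt tgtQ.
- exact: arrow_elt_out.
move=> p ps pt /(short_pathP k)[[pe _]|[a [ha pa pa' pb]]].
  by move: pt; rewrite pe ps.
rewrite srcQ // ps in pa; rewrite tgtQ // pt in pa'.
by rewrite /hasB /eltB; case: pa pa' => -> [->]; rewrite -surjective_pairing.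
Qed.

Lemma hasB_shift : stable_quiver (@shift_pm n) (@shift_arr n) Q ->
  forall i j, hasB Q i j -> hasB Q (i + 1) (j + 1).
Proof. by case=> _ stA i j /stA. Qed.

Lemma hasB_vertex i j : hasB Q i j -> (inl i \in verts Q) /\ (inr j \in verts Q).
Proof.
have [_ _ srcQ tgtQ] := Q_sub => ha.
by have /andP[] := arrs_closed ha; rewrite srcQ // tgtQ.
Qed.
End SystemB.

(** * Formulas for the action on a path algebra *)

Section Formulas.
Variables (k : fieldType) (n : nat) (q : k).
Hypotheses (n_ge3 : (3 <= n)%N) (q_prim : (2 * n)%N.-primitive_root q).
Variables (V A : finType) (Q : quiver V A).
Local Notation kQ := (path_alg k Q).
Variable (act : uq_term k -> {linear kQ -> kQ}).
Hypotheses (actP : uq_action n q act) (filtP : preserves_filtration act).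
Let n0 := prim2n_gt0 q_prim.
Let q0 := prim2n_neq0 q_prim.

Definition vertex_scalars_at (s : 'Z_n -> V) (gE gF : k) : Prop :=
  uq_vertex_scalars q (act UqE) (act UqF) 1 (fun i => vertex_elt k Q (s i))
    (gammaE q gE) (gammaF q gF).

Lemma vertex_scalars_at_formula s gE gF : vertex_scalars_at s gE gF ->
  forall i, let e i := vertex_elt k Q (s i) in
  act UqE (e i) = gE *: (q ^- (2 * i)%N *: (e i - q ^- 2 *: e (i + 1))) /\
  act UqF (e i) = gF *: (q ^+ (2 * i)%N *: (e (i - 1) - q ^+ 2 *: e i)).
Proof.
by move=> sc i e; exact: (vertex_scalars_formula n_ge3 q_prim).
Qed.

(** By stability either all or none of the vertices s i are present, so the scalars
    can be chosen once for the whole family. *)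
Lemma vertices_formula (s : 'Z_n -> V) : injective s ->
    (forall i, s i \in verts Q -> s (i + 1) \in verts Q) ->
    (forall i, s i \in verts Q ->
       act UqK (vertex_elt k Q (s i)) = vertex_elt k Q (s (i + 1))) ->
  exists gE gF, gamma_condition q gE gF /\
    forall i, s i \in verts Q ->
      [/\ forall j, s j \in verts Q,
          uq_vertex_family (@path_mul k V A Q) (act UqK) (act (UqKV k n))
            (act UqE) (act UqF) 1 (fun i => vertex_elt k Q (s i)) &
          vertex_scalars_at s gE gF].
Proof.
move=> s_inj s_shift Ks.
have sV i j : s i \in verts Q -> s j \in verts Q.
  move=> hi; pose P l (_ : 'Z_n) : Prop := s l \in verts Q.
  have := shift_closed (P := P) (j := 0) _ hi (j - i).
  by rewrite /P addrCA subrr addr0; apply=> *; apply: s_shift.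
have [h0|n0v] := boolP (s 0 \in verts Q); last first.
  have [gE [gF g1]] := gamma_condition_ex q_prim (ltnW n_ge3); exists gE, gF; split=> // i hi.
  by rewrite (sV i 0 hi) in n0v.
have hV j : s j \in verts Q := sV 0 j h0.
have fam := uq_path_vertex_family n0 actP filtP s_inj hV (fun i => Ks i (hV i)).
have [gE [gF [g1 sc]]] := uq_vertex_familyP n_ge3 q_prim (path_algebra_mul k Q)
  (uq_path_algebra_action n0 q0 actP) fam.
by exists gE, gF.
Qed.

(** Both types of quiver are instances: s = t for the vertices of the complete
    quiver, s and t the two sides for the bipartite one. *)
Lemma arrows_formula (s t : 'Z_n -> V) (has : 'Z_n -> 'Z_n -> bool)
    (elt : 'Z_n -> 'Z_n -> kQ) (mu c : 'Z_n -> 'Z_n -> k) gEs gFs gEt gFt :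
    (forall i, s i \in verts Q) -> (forall j, t j \in verts Q) ->
    uq_vertex_family (@path_mul k V A Q) (act UqK) (act (UqKV k n))
      (act UqE) (act UqF) 1 (fun i => vertex_elt k Q (s i)) ->
    uq_vertex_family (@path_mul k V A Q) (act UqK) (act (UqKV k n))
      (act UqE) (act UqF) 1 (fun j => vertex_elt k Q (t j)) ->
    vertex_scalars_at s gEs gFs -> vertex_scalars_at t gEt gFt ->
    short_path_system s t has elt ->
    (forall i j, has i j -> has (i + 1) (j + 1)) ->
    (forall i j, has i j -> act UqK (elt i j) = mu i j *: elt (i + 1) (j + 1)) ->
    normalizes has mu c ->
  let x i j := c i j *: elt i j in
  exists lE lF : 'Z_n -> 'Z_n -> k, forall i j, has i j ->
  [/\ act UqE (x i j) = (gEt * q ^- (2 * j)%N) *: x i j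
                  - (gEs * q ^- (2 * i + 2)%N) *: x (i + 1) (j + 1)
                  + lE i j *: x i (j + 1) /\
      act UqF (x i j) = (gFt * q ^+ (2 * j)%N) *: x (i - 1) (j - 1)
                  - (gFs * q ^+ (2 * i + 2)%N) *: x i j + lF i j *: x (i - 1) j,
      (~~ has i (j + 1) -> lE i j = 0) /\ (~~ has (i - 1) j -> lF i j = 0),
      lE (i + 1) (j + 1) = q ^- 2 * lE i j /\ lF (i + 1) (j + 1) = q ^+ 2 * lF i j,
      lF i j * lE (i - 1) j = lE i j * lF i (j + 1) &
      gEs ^+ n = gEt ^+ n + \prod_(l < n) lE i (j + l%:R) /\
      gFs ^+ n = gFt ^+ n + \prod_(l < n) lF i (j + l%:R)].
Proof.
move=> sV tV sfam tfam sG tG sys has_shift Kelt cP x.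
have x_out i j : ~~ has i j -> x i j = 0.
  by move=> nh; rewrite /x (short_path_out sys nh) scaler0.
have x_neq0 i j : has i j -> x i j != 0.
  move=> h; have [p [_ _ _ ep]] := short_path_in sys h.
  by rewrite scaler_eq0 ep (negbTE (pbasis_neq0 k p)) orbF; case: (cP _ _ h).
have fam : uq_path_family (@path_mul k V A Q) (act UqK) (act (UqKV k n))
      (act UqE) (act UqF) 1 (fun i => vertex_elt k Q (s i))
      (fun j => vertex_elt k Q (t j)) x.
  apply: (uq_path_path_family n0 actP filtP sV tV) => i j.
  - have [h|/x_out] := boolP (has i j); last by left.
    have [p [ps pt le1 ep]] := short_path_in sys h.
    by right; exists p, (c i j); rewrite /x ep.
  - move=> p ps pt le1; have [h ep] := short_path_only sys ps pt le1.
    exists (c i j)^-1; rewrite /x scalerA mulVf ?scale1r //.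
    by case: (cP _ _ h).
  have [h|nh] := boolP (has i j).
    by have [_ cmu] := cP _ _ h; apply: linear_rescale (Kelt _ _ h) cmu.
  rewrite !x_out ?linear0 //; apply: contra nh => h.
  have := shift_closed (P := has) has_shift h (-1).
  by rewrite !addrK.
have [lE [lF lP]] := uq_path_familyP n_ge3 q_prim (path_algebra_mul k Q)
  (uq_path_algebra_action n0 q0 actP) sfam tfam sG tG fam
  (uq_act_En actP) (uq_act_Fn actP).
exists lE, lF => i j h; have [EF [lE0 lF0] lsh comm pow] := lP i j (x_neq0 i j h).
split; [exact: EF | | exact: lsh | exact: comm | exact: pow].
by split=> [/x_out/lE0 | /x_out/lF0].
Qed.

End Formulas.

Theorem theorem8p10 (k : fieldType) (n : nat) (q : k)
    (n_ge3 : (3 <= n)%N) (q_prim : (2 * n)%N.-primitive_root q) :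
  (* Type A *)
  (forall (Q : quiver 'Z_n ('Z_n * 'Z_n)%type) (mu : 'Z_n -> 'Z_n -> k)
      (act : uq_term k -> {linear path_alg k Q -> path_alg k Q}),
    subquiver Q (Kn n) ->
    stable_quiver (@shift1 n) (@shift_arr n) Q ->
    orbit_scalars (hasA Q) mu ->
    (forall i, mu i i = 1) ->
    uq_action n q act ->
    preserves_filtration act ->
    (forall i j, hasA Q i j ->
      act UqK (eltA k Q i j) = mu i j *: eltA k Q (i + 1) (j + 1)) ->
    exists gE gF : k,
      - (gE * gF * q^-1 * (q ^+ 2 - 1) ^+ 2) = 1 /\
      (exists c : 'Z_n -> 'Z_n -> k,
        (forall i, c i i = 1) /\ normalizes (hasA Q) mu c) /\
      (forall c : 'Z_n -> 'Z_n -> k,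
        (forall i, c i i = 1) -> normalizes (hasA Q) mu c ->
        let a i j := c i j *: eltA k Q i j in
        exists lE lF : 'Z_n -> 'Z_n -> k,
          forall i j : 'Z_n, hasA Q i j ->
          [/\ act UqE (a i j) =
                gE *: (q ^- (2 * j)%N *: a i j
                       - q ^- (2 * i + 2)%N *: a (i + 1) (j + 1))
                + lE i j *: a i (j + 1),
              act UqF (a i j) =
                gF *: (q ^+ (2 * j)%N *: a (i - 1) (j - 1)
                       - q ^+ (2 * i + 2)%N *: a i j)
                + lF i j *: a (i - 1) j,
              (i = j \/ ~~ hasA Q i (j + 1) -> lE i j = 0) /\
              (i = j \/ ~~ hasA Q (i - 1) j -> lF i j = 0),
              lE (i + 1) (j + 1) = q ^- 2 * lE i j /\
              lF (i + 1) (j + 1) = q ^+ 2 * lF i j &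
              lF i j * lE (i - 1) j = lE i j * lF i (j + 1)]))
  /\
  (* Type B *)
  (forall (Q : quiver ('Z_n + 'Z_n)%type ('Z_n * 'Z_n)%type)
      (mu : 'Z_n -> 'Z_n -> k)
      (act : uq_term k -> {linear path_alg k Q -> path_alg k Q}),
    subquiver Q (Knn n) ->
    stable_quiver (@shift_pm n) (@shift_arr n) Q ->
    orbit_scalars (hasB Q) mu ->
    uq_action n q act ->
    preserves_filtration act ->
    (forall v, v \in verts Q ->
      act UqK (vertex_elt k Q v) = vertex_elt k Q (shift_pm v)) ->
    (forall i j, hasB Q i j ->
      act UqK (eltB k Q i j) = mu i j *: eltB k Q (i + 1) (j + 1)) ->
    let ep i := vertex_elt k Q (inl i) in
    let em i := vertex_elt k Q (inr i) in
    exists gEp gEm gFp gFm : k,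
      [/\ - (gEp * gFp * q^-1 * (q ^+ 2 - 1) ^+ 2) = 1,
          - (gEm * gFm * q^-1 * (q ^+ 2 - 1) ^+ 2) = 1,
          forall i : 'Z_n, inl i \in verts Q ->
            act UqE (ep i) =
              gEp *: (q ^- (2 * i)%N *: (ep i - q ^- 2 *: ep (i + 1))) /\
            act UqF (ep i) =
              gFp *: (q ^+ (2 * i)%N *: (ep (i - 1) - q ^+ 2 *: ep i)) &
          forall i : 'Z_n, inr i \in verts Q ->
            act UqE (em i) =
              gEm *: (q ^- (2 * i)%N *: (em i - q ^- 2 *: em (i + 1))) /\
            act UqF (em i) =
              gFm *: (q ^+ (2 * i)%N *: (em (i - 1) - q ^+ 2 *: em i))] /\
      (exists c : 'Z_n -> 'Z_n -> k, normalizes (hasB Q) mu c) /\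
      (forall c : 'Z_n -> 'Z_n -> k, normalizes (hasB Q) mu c ->
        let b i j := c i j *: eltB k Q i j in
        exists lE lF : 'Z_n -> 'Z_n -> k,
          forall i j : 'Z_n, hasB Q i j ->
          [/\ act UqE (b i j) =
                (gEm * q ^- (2 * j)%N) *: b i j
                - (gEp * q ^- (2 * i + 2)%N) *: b (i + 1) (j + 1)
                + lE i j *: b i (j + 1) /\
              act UqF (b i j) =
                (gFm * q ^+ (2 * j)%N) *: b (i - 1) (j - 1)
                - (gFp * q ^+ (2 * i + 2)%N) *: b i j
                + lF i j *: b (i - 1) j,
              (inl i = inr j :> 'Z_n + 'Z_n \/ ~~ hasB Q i (j + 1) ->
                lE i j = 0) /\
              (inl i = inr j :> 'Z_n + 'Z_n \/ ~~ hasB Q (i - 1) j ->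
                lF i j = 0),
              lE (i + 1) (j + 1) = q ^- 2 * lE i j /\
              lF (i + 1) (j + 1) = q ^+ 2 * lF i j,
              lF i j * lE (i - 1) j = lE i j * lF i (j + 1) &
              gEp ^+ n = gEm ^+ n + \prod_(l < n) lE i (j + l%:R) /\
              gFp ^+ n = gFm ^+ n + \prod_(l < n) lF i (j + l%:R)])).
Proof.
have n_gt1 : (1 < n)%N := ltnW n_ge3.
split=> [Q mu act Q_sub Q_stab muP mu1 actP filtP KP
        |Q mu act Q_sub Q_stab muP actP filtP Kv Ka ep em].
  have sh := hasA_shift Q_stab; have [stV _] := Q_stab.
  have hasii i : hasA Q i i = (i \in verts Q) by rewrite /hasA eqxx.
  have eltii i : eltA k Q i i = vertex_elt k Q i by rewrite /eltA eqxx.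
  have Kv i : i \in verts Q ->
      act UqK (vertex_elt k Q i) = vertex_elt k Q (i + 1).
    by move=> hi; rewrite -!eltii KP ?hasii // mu1 scale1r.
  have [gE [gF [g1 gP]]] :=
    vertices_formula n_ge3 q_prim actP filtP (@inj_id _) stV Kv.
  exists gE, gF; split=> //; split.
    have [c [cP c1]] := normalizer_exists n_gt1 sh muP.
    by exists c; split=> //; apply: c1.
  move=> c c1 cP a.
  have [h0|n0v] := boolP (0 \in verts Q); last first.
    exists (fun _ _ => 0), (fun _ _ => 0) => i j /(hasA_vertex Q_sub) hi.
    by have [/(_ 0)] := gP i hi; rewrite (negbTE n0v).
  have [hV fam sc] := gP 0 h0.
  have [lE [lF lP]] := arrows_formula n_ge3 q_prim actP filtP hV hV fam fam sc sc
    (eltA_system k Q_sub) sh KP cP.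
  exists lE, lF => i j h; have [[Eij Fij] [lE0 lF0] lsh comm _] := lP i j h.
  have a_neq0 i' j' : hasA Q i' j' -> a i' j' != 0.
    move=> h'; have [p [_ _ _ ep]] := short_path_in (eltA_system k Q_sub) h'.
    by rewrite scaler_eq0 ep (negbTE (pbasis_neq0 k p)) orbF; case: (cP _ _ h').
  have aii i' : a i' i' = vertex_elt k Q i' by rewrite /a c1 eltii scale1r.
  have lii : i = j ->
      (hasA Q i (j + 1) -> lE i j = 0) /\ (hasA Q (i - 1) j -> lF i j = 0).
    move=> eij; rewrite -eij in Eij Fij *.
    have [l0 m0] := vertex_path_scalars0 n_ge3 q_prim sc aii Eij Fij.
    by split=> [/a_neq0/l0 | /a_neq0/m0].
  split; [exact: scaler_factor Eij | exact: scaler_factor Fij | | exact: lsh | exact: comm].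
  split=> [[/lii[l0 _]|/lE0 //]|[/lii[_ l0]|/lF0 //]].
    by have [/l0|/lE0] := boolP (hasA Q i (j + 1)).
  by have [/l0|/lF0] := boolP (hasA Q (i - 1) j).
have sh := hasB_shift Q_stab; have [stV _] := Q_stab.
have [gEp [gFp [g1p gPp]]] := vertices_formula n_ge3 q_prim actP filtP (s := inl)
  (@inl_inj _ _) (fun i => stV (inl i)) (fun i => Kv (inl i)).
have [gEm [gFm [g1m gPm]]] := vertices_formula n_ge3 q_prim actP filtP (s := inr)
  (@inr_inj _ _) (fun i => stV (inr i)) (fun i => Kv (inr i)).
exists gEp, gEm, gFp, gFm; split; last split.
- split=> // i hi.
    have [_ _ sc] := gPp i hi; exact: (vertex_scalars_at_formula n_ge3 q_prim sc i).
  have [_ _ sc] := gPm i hi; exact: (vertex_scalars_at_formula n_ge3 q_prim sc i).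
- by have [c [cP _]] := normalizer_exists n_gt1 sh muP; exists c.
move=> c cP b.
have [h0|n0v] := boolP ((inl 0 \in verts Q) && (inr 0 \in verts Q)); last first.
  exists (fun _ _ => 0), (fun _ _ => 0) => i j /(hasB_vertex Q_sub)[hi hj].
  have [/(_ 0) hp _ _] := gPp i hi; have [/(_ 0) hm _ _] := gPm j hj.
  by rewrite hp hm in n0v.
have [/gPp[pV famp scp] /gPm[mV famm scm]] := andP h0.
have [lE [lF lP]] := arrows_formula n_ge3 q_prim actP filtP pV mV famp famm scp scm
  (eltB_system k Q_sub) sh Ka cP.
exists lE, lF => i j h; have [EFij [lE0 lF0] lsh comm pow] := lP i j h.
by split; [exact: EFij | split=> -[] | exact: lsh | exact: comm | exact: pow].
Qed.
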